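(* Let $(G,S)$ be a right-angled Artin group. For all $w\in G$, $\bullet_w=\bigcap_{p\in\mathrm{Prim}(w)}\bullet_p$, i.e. for all $x,y\in G$, $$x\preceq_w y\iff x\preceq_p y\ \text{ for all } p\in\mathrm{Prim}(w).$$
   Context: $(G,S)$ is a right-angled Artin group: $S\subseteq G$ is a (possibly infinite) generating set of the group $G$ with $S\cap S^{-1}=\emptyset$, and $G$ has the presentation $\langle S\,;\,[s,t]=1$ for those $s\neq t$ in $S$ with $st=ts$ in $G\rangle$. Let $l$ be the word length on $G$ with respect to $S\cup S^{-1}$. Write $x\subset y$ iff $l(x)+l(x^{-1}y)=l(y)$; this is a partial order with least element $1$, in which any two elements have a greatest lower bound $x\cap y$. Elements $x,y$ are orthogonal, $x\perp y$, if $x\cap y=1$ and $x,y$ have a least upper bound for $\subset$ (equivalently, a common upper bound). Put $[x,y]=\{z\in G: x^{-1}z\subset x^{-1}y\}$ and $Y(x,y,z)=x(x^{-1}y\cap x^{-1}z)$, the unique element of $[x,y]\cap[y,z]\cap[z,x]$. A subset $I$ is convex if $[x,y]\subseteq I$ for all $x,y\in I$; the convex closure of a set is the smallest convex set containing it. An element $w$ is cyclically reduced if $w\cap w^{-1}=1$. For $w\in G$ put $\varphi_w(x)=Y(wx,x,w^{-1}x)$ and $X_w=\varphi_w(G)=\{x\in G: x^{-1}wx \text{ is cyclically reduced}\}$. For a cyclically reduced $v$ let $X_{v,1}$ be the convex closure of $\{v^n:n\in\mathbb Z\}$ and $H_v=Z_G(v)\cap X_{v,1}$. An element $w\neq1$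 is primitive if for some (equivalently, for all) $a\in X_w$ the group $H_{a^{-1}wa}$ is cyclic, generated by $a^{-1}wa$. Every $w\in G$ can be written, uniquely up to order of the factors, as $w=\prod_{i=1}^n p_i^{m_i}$ with $p_i$ primitive, $m_i\ge1$, and $a^{-1}p_ia\perp a^{-1}p_ja$ for all $i\neq j$ and all $a\in X_w$; $\mathrm{Prim}(w)=\{p_1,\dots,p_n\}$ (so $\mathrm{Prim}(1)=\emptyset$). For $w\in G$, $\preceq_w$ is the preorder on $G$ given by $x\preceq_wy\iff y\in[x,wy]$. It determines a binary operation (quasidirection) $\bullet_w$ on $G$ with $x\preceq_w y\iff y\bullet_w x=y$; the equality $\bullet_w=\bigcap_p\bullet_p$ means by definition that the preorder $\preceq_w$ is the intersection of the preorders $\preceq_p$, as spelled out in the displayed equivalence. *)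

(* Defs.v *)
From mathcomp Require Import all_boot all_classical.
From Stdlib Require Import Relation_Operators.

Set Implicit Arguments.
Unset Strict Implicit.
Unset Printing Implicit Defensive.

Local Open Scope classical_set_scope.
Local Open Scope group_scope.

Section RightAngledArtin.
Variables (G : groupType) (S : set G).

(* Words in the free group on S: the letter (s, false) stands for s and
   (s, true) for the formal inverse of s. *)
Definition word : Type := seq (set_type S * bool).

Definition letter (a : set_type S * bool) : G :=
  if a.2 then (val a.1)^-1 else val a.1.

Definition eval (u : word) : G := \prod_(a <- u) letter a.

Inductive raag_step : word -> word -> Prop :=
| raag_cancel (u v : word) (s : set_type S) (b : bool) :
    raag_step (u ++ [:: (s, b); (s, ~~ b)] ++ v) (u ++ v)
| raag_swap (u v : word) (s t : set_type S) :
    s <> t -> commute (val s) (val t) ->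
    raag_step (u ++ [:: (s, false); (t, false)] ++ v)
              (u ++ [:: (t, false); (s, false)] ++ v).

(* Equality in the abstract group < S ; [s, t] = 1 >. *)
Definition raag_eq : word -> word -> Prop := clos_refl_sym_trans word raag_step.

Record is_raag : Prop := IsRaag {
  raag_disjoint : S `&` [set s^-1 | s in S] = set0;
  raag_generated : forall x : G, exists u : word, eval u = x;
  raag_presented : forall u v : word, eval u = eval v <-> raag_eq u v
}.

Definition is_length (x : G) (n : nat) : Prop :=
  (exists u : word, eval u = x /\ size u = n) /\
  (forall u : word, eval u = x -> (n <= size u)%N).

Definition len (x : G) : nat := xget 0%N [set n | is_length x n].

Definition sub (x y : G) : Prop := (len x + len (x^-1 * y)%g = len y)%N.

Definition is_glb (x y z : G) : Prop :=
  [/\ sub z x, sub z y & forall u, sub u x -> sub u y -> sub u z].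

Definition is_lub (x y z : G) : Prop :=
  [/\ sub x z, sub y z & forall u, sub x u -> sub y u -> sub z u].

(* In a right-angled Artin group the greatest lower bound always exists, so the
   default value 1 is never used. *)
Definition meet (x y : G) : G := xget 1 [set z | is_glb x y z].

Definition orthogonal (x y : G) : Prop :=
  meet x y = 1 /\ exists z, is_lub x y z.

Definition interval (x y : G) : set G := [set z | sub (x^-1 * z) (x^-1 * y)].

Definition median (x y z : G) : G := x * meet (x^-1 * y) (x^-1 * z).

Definition convex (I : set G) : Prop :=
  forall x y, I x -> I y -> interval x y `<=` I.

Definition phi (w x : G) : G := median (w * x) x (w^-1 * x).

(* x is in Xset w iff v := x^-1 w x is cyclically reduced, i.e. meet v v^-1 = 1;
   H below is used for such v only. *)
Definition Xset (w : G) : set G := range (phi w).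

Definition zpowers (v : G) : set G :=
  [set z | exists n : nat, z = v ^+ n \/ z = v ^- n].

Definition X1 (v : G) : set G := smallest convex (zpowers v).

Definition H (v : G) : set G := [set z | commute z v] `&` X1 v.

Definition primitive (w : G) : Prop :=
  w <> 1 /\
  exists a, Xset w a /\ H (a^-1 * w * a) = zpowers (a^-1 * w * a).

Definition prim_decomp (w : G) (n : nat) (p : 'I_n -> G) (m : 'I_n -> nat) :
    Prop :=
  [/\ w = \prod_(i < n) p i ^+ m i,
      forall i, primitive (p i),
      forall i, (1 <= m i)%N &
      forall i j, i <> j -> forall a, Xset w a ->
        orthogonal (a^-1 * p i * a) (a^-1 * p j * a)].

(* By existence and uniqueness of the decomposition, the set of factors of the
   decomposition of w. *)
Definition Prim (w : G) : set G :=
  [set q | exists (n : nat) (p : 'I_n -> G) (m : 'I_n -> nat),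
             prim_decomp w p m /\ exists i, q = p i].

Definition prec (w x y : G) : Prop := interval x (w * y) y.

End RightAngledArtin.

(* Main.v *)
Require Import Defs.
From mathcomp Require Import all_boot all_classical.
From mathcomp Require Import zify.

(* A relation x <=_w y holds iff no letter can cancel in the product of x^-1 y
   and y^-1 w y, so the theorem says: the first letters of w are the first
   letters of its primitive factors.  The latter is stable under a reduced
   conjugation by a letter s, because s either lengthens a factor by 2 at both
   ends or commutes with all its letters; so one can start from the cyclically
   reduced conjugate of w, whose factors have commuting disjoint supports.

   The decomposition exists because, for v cyclically reduced, the elements
   below powers of v that commute with v are closed under meets.  A shortest
   nontrivial one p below v is primitive, and v = p^k z with p orthogonal to z.

   The geometry of G rests on the word problem, solved by letting the letters
   act on reduced words up to commutation. *)

(** The dichotomy for a factor under conjugation by [s] holds when [s] is neither a first nor a last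
    letter of it. Last letters are first letters of the inverse, so every statement about first
    letters is carried along for [w] and [w^-1] together. Some factor must really be lengthened, as
    it alone can supply the new first letter; this follows since a letter fixing all factors would
    fix [w], whose length grows.

    A decomposition asks for orthogonality at every cyclic reduction of [w], while the construction
    yields it at one. Along a reduced word leading from one cyclic reduction to another, every
    intermediate conjugate is again cyclically reduced, and each single letter moves at most one
    factor, so orthogonality is transported letter by letter.

    [Prim w] collects the factors of all decompositions: one implication treats an arbitrary
    decomposition, the other the constructed one. *)

Set Implicit Arguments.
Unset Strict Implicit.
Unset Printing Implicit Defensive.

Local Open Scope classical_set_scope.
Local Open Scope group_scope.

(** * Words up to commutation, and the action of letters on reduced words *)

Section Words.
Variables (G : groupType) (S : set G).
Local Notation L := (set_type S * bool)%type.
Implicit Types (a b c s t : L) (u v w r : seq L) (x y z : G).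

Definition linv a : L := (a.1, ~~ a.2).

(** A letter counts as dependent on itself and on its inverse, so that passing over an independent
    letter is a swap and never a cancellation. *)
Definition ind a b : bool :=
  (a.1 != b.1) && (val a.1 * val b.1 == val b.1 * val a.1).

Definition winv u : seq L := rev (map linv u).

Lemma linvK : involutive linv.
Proof. by case=> i b; rewrite /linv /= negbK. Qed.

Lemma linv_neq a : linv a == a = false.
Proof. by case: a => i b; rewrite /linv xpair_eqE eqxx /=; case: b. Qed.

Lemma neq_linv a : a == linv a = false.
Proof. by rewrite eq_sym linv_neq. Qed.

Lemma ind_sym a b : ind a b = ind b a.
Proof. by rewrite /ind eq_sym [_ * _ == _]eq_sym. Qed.

Lemma indVl a b : ind (linv a) b = ind a b. Proof. by []. Qed.

Lemma indVr a b : ind a (linv b) = ind a b. Proof. by []. Qed.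

Lemma ind_irr a : ind a a = false.
Proof. by rewrite /ind eqxx. Qed.

Lemma ind_neq a b : ind a b -> b == a = false.
Proof. by move=> ab; apply/eqP=> e; rewrite e ind_irr in ab. Qed.

Lemma ind_neqV a b : ind a b -> b == linv a = false.
Proof. by rewrite -indVl => /ind_neq. Qed.

Lemma letterV a : letter (linv a) = (letter a)^-1.
Proof. by case: a => i [] /=; rewrite /letter /= ?invgK. Qed.

Lemma ind_commute a b : ind a b -> commute (letter a) (letter b).
Proof.
case/andP=> _ /eqP h.
have h' : commute (val a.1) (val b.1) by [].
rewrite /letter; case: a.2; case: b.2 => //.
- by apply/commuteV/commute_sym/commuteV/commute_sym.
- by apply/commute_sym/commuteV/commute_sym.
- exact/commuteV.
Qed.

Lemma eval_nil : eval (S := S) [::] = 1.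
Proof. by rewrite /eval big_nil. Qed.

Lemma eval_cons a u : eval (a :: u) = letter a * eval u.
Proof. by rewrite /eval big_cons. Qed.

Lemma eval_cat u v : eval (u ++ v) = eval u * eval v.
Proof. by rewrite /eval big_cat. Qed.

Lemma eval_seq1 a : eval [:: a] = letter a.
Proof. by rewrite eval_cons eval_nil mulg1. Qed.

Lemma eval_winv u : eval (winv u) = (eval u)^-1.
Proof.
elim: u => [|a u IH]; first by rewrite eval_nil invg1.
rewrite /winv /= rev_cons -cats1 eval_cat eval_seq1 eval_cons invgM letterV.
by rewrite -IH.
Qed.

Lemma size_winv u : size (winv u) = size u.
Proof. by rewrite size_rev size_map. Qed.

Lemma all_ind_winv a u : all (ind a) (winv u) = all (ind a) u.
Proof. by rewrite all_rev all_map; apply: eq_all => b /=; rewrite indVr. Qed.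

Lemma all_ind_commute a u : all (ind a) u -> commute (letter a) (eval u).
Proof.
elim: u => [|b u IH] /=; first by rewrite eval_nil => _; apply: commute1.
by case/andP=> ab /IH au; rewrite eval_cons; apply: commuteM => //;
  apply: ind_commute.
Qed.

(* Trace equivalence, through the projections to pairs of dependent generators:
   reduced words are equal in G iff they have the same projections. *)
Definition pairproj a b u : seq L := [seq c <- u | (c.1 == a.1) || (c.1 ==
  b.1)].

Definition treq u v := forall a b, ~~ ind a b ->
  pairproj a b u = pairproj a b v.

Lemma pairproj_cat a b u v : pairproj a b (u ++ v) = pairproj a b u ++
  pairproj a b v.
Proof. exact: filter_cat. Qed.

Lemma treq_refl u : treq u u. Proof. by []. Qed.

Lemma treq_sym u v : treq u v -> treq v u.
Proof. by move=> h a b /h. Qed.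

Lemma treq_trans v u w : treq u v -> treq v w -> treq u w.
Proof. by move=> h1 h2 a b ab; rewrite h1 ?h2. Qed.

Lemma treq_cat u u' v v' : treq u u' -> treq v v' -> treq (u ++ v) (u' ++ v').
Proof. by move=> h1 h2 a b ab; rewrite !pairproj_cat h1 ?h2. Qed.

Lemma treq_cons a u v : treq u v -> treq (a :: u) (a :: v).
Proof. exact: (@treq_cat [:: a] [:: a]). Qed.

Lemma treq_cons_inj a u v : treq (a :: u) (a :: v) -> treq u v.
Proof.
by move=> h b c /h; rewrite /pairproj /=; case: ifP => // _ [].
Qed.

Lemma treq_swap a b u : ind a b -> treq (a :: b :: u) (b :: a :: u).
Proof.
move=> iab c d cd; rewrite /pairproj /=.
case: ifP => ha; case: ifP => hb //.
(* Both letters survive the projection only if they make up the pair [c], [d], which would then be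
   independent. *)
case/negP: cd; move: iab; rewrite /ind => /andP[n /eqP e].
move: ha hb => /orP[]/eqP ha /orP[]/eqP hb.
- by rewrite ha hb eqxx in n.
- by rewrite -ha -hb n e eqxx.
- by rewrite -ha -hb eq_sym n e eqxx.
- by rewrite ha hb eqxx in n.
Qed.

Lemma treq_size u v : treq u v -> size u = size v.
Proof.
move=> h; apply/perm_size/permP => P.
have count_pairproj w a : count_mem a w = count_mem a (pairproj a a w).
  rewrite /pairproj count_filter; apply: eq_count => b /=.
  by case: eqP => [->|//]; rewrite eqxx.
have : perm_eq u v.
  by apply/allP => a _ /=; rewrite count_pairproj (h a a) ?ind_irr //
    -count_pairproj.
by move/permP.
Qed.

Lemma treq_mem u v : treq u v -> u =i v.
Proof.
move=> h a; have:= h a a; rewrite ind_irr => /(_ isT) /(congr1 (fun w =>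
  a \in w)).
by rewrite !mem_filter eqxx.
Qed.

(** Tries to bring an [a] to the front by swaps. By [del_treq] and [treq_del] it succeeds exactly
    when [u] is trace equivalent to some [a :: v], so the outcome is an invariant of the trace. *)
Fixpoint del a u : option (seq L) :=
  if u is c :: v then
    if c == a then Some v
    else if ind a c then omap (cons c) (del a v) else None
  else None.

Lemma del_treq a u v : del a u = Some v -> treq u (a :: v).
Proof.
elim: u v => //= c u IH v; case: eqP => [-> [->] //|_].
case: ifP => // ac; case E: (del a u) => [w|//] [<-].
apply: treq_trans (treq_swap _ _); last by rewrite ind_sym.
exact/treq_cons/IH.
Qed.

(** A dependent letter standing before the first [a] would head the projection to the pair it forms
    with [a]; an independent one is invisible in all projections considered. *)
Lemma del_isSome a u :
  (forall b, ~~ ind a b -> ohead (pairproj a b u) = Some a) -> del a u.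
Proof.
elim: u => [|c u IH] h /=.
  by have := h a; rewrite ind_irr => /(_ isT).
case: eqP => // ca; case: ifP => [ac|/negbT ac].
  suff : del a u by case: (del a u).
  apply: IH => b ab; rewrite -(h b ab) /pairproj /=; case: ifP => // hc.
  case/negP: ab; move: ac hc; rewrite /ind => /andP[n e].
  by rewrite eq_sym (negbTE n) /= => /eqP <-; rewrite n e.
by move: (h c ac); rewrite /pairproj /= eqxx orbT => -[].
Qed.

Lemma treq_del a u v :
  treq u (a :: v) -> exists2 v', del a u = Some v' & treq v' v.
Proof.
move=> h; have : del a u.
  by apply: del_isSome => b ab; rewrite h // /pairproj /= eqxx.
case E: (del a u) => [v'|//] _; exists v' => //.
exact: treq_cons_inj (treq_trans (treq_sym (del_treq E)) h).
Qed.

Lemma treq_isSome a u v : treq u v -> del a u = del a v :> bool.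
Proof.
suff h w w' : treq w w' -> del a w -> del a w'.
  by move=> uv; apply/idP/idP; apply: h => //; apply: treq_sym.
case E: (del a w) => [r|//] ww' _.
by have [? -> _] := treq_del (treq_trans (treq_sym ww') (del_treq E)).
Qed.

Lemma treq_eval u v : treq u v -> eval u = eval v.
Proof.
have del_eval a w r : del a w = Some r -> eval w = letter a * eval r.
  elim: w r => //= c w IH r; case: eqP => [-> [->]|_];
    first by rewrite eval_cons.
  case: ifP => // ac; case E: (del a w) => [r'|//] [<-].
  rewrite !eval_cons (IH _ E) !mulgA; congr (_ * _).
  exact/commute_sym/ind_commute.
elim: v u => [|a v IH] u h; first by rewrite (size0nil (treq_size h)).
by have [v' E /IH {}IH] := treq_del h; rewrite (del_eval _ _ _ E) IH eval_cons.
Qed.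

Lemma del_cat a u v :
  del a (u ++ v) = del a u || (all (ind a) u && del a v) :> bool.
Proof.
elim: u => //= c u; case: eqP => // _; case: (ind a c) => //=.
by case: (del a (u ++ v)); case: (del a u) => //= ->.
Qed.

Lemma del_mem a u : del a u -> a \in u.
Proof.
elim: u => //= c u IH; rewrite inE eq_sym; case: eqP => //= _.
by case: ifP => // _; case: (del a u) IH => // r ->.
Qed.

(** No letter can meet its inverse after swaps; [redE] identifies this with having minimal
    length. *)
Fixpoint red u : bool :=
  if u is a :: v then ~~ del (linv a) v && red v else true.

Lemma red_del a u v : red u -> del a u = Some v -> red v /\ ~~ del (linv a) v.
Proof.
elim: u v => //= c u IH v /andP[nc ru].
case: eqP => [ca [<-]|_]; first by rewrite -ca.
case: ifP => // ac; case E: (del a u) => [w|//] [<-] /=.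
have [-> na] := IH _ ru E; rewrite ind_neqV // indVl ac andbT; split.
  (* If the inverse of [c] came to the front of [w], it would pass over [a] and come to the front of
     [u]. *)
  apply: contra nc; case E': (del (linv c) w) => [w'|//] _.
  have [|r -> //] := @treq_del (linv c) u (a :: w').
  apply: treq_trans (del_treq E) (treq_trans (treq_cons _ (del_treq E')) _).
  exact: treq_swap.
by case: (del (linv a) w) na.
Qed.

(** Left multiplication by a letter on reduced words up to [treq]. As in van der Waerden's proof of
    normal forms, it suffices that this action respects the defining relations, which is [act_inv]
    and [act_comm]. *)
Definition act a u : seq L := if del (linv a) u is Some v then v else a :: u.

Definition nf u : seq L := foldr act [::] u.

Lemma nf_red u : red (nf u).
Proof.
elim: u => //= a u IH; rewrite /act.
by case E: (del _ _) => [v|] /=; [have [] := red_del IH E | rewrite E IH].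
Qed.

Lemma act_treq a u v : treq u v -> treq (act a u) (act a v).
Proof.
move=> h; rewrite /act; case E: (del _ u) => [u'|].
  have [v' -> h'] := treq_del (treq_trans (treq_sym h) (del_treq E)).
  exact: treq_sym.
have:= treq_isSome (linv a) h; rewrite E; case: (del _ v) => // _.
exact: treq_cons.
Qed.

Lemma foldr_act_treq w u v :
  treq u v -> treq (foldr act u w) (foldr act v w).
Proof. by move=> h; elim: w => //= a w; apply: act_treq. Qed.

Lemma act_inv a u : red u -> treq (act a (act (linv a) u)) u.
Proof.
move=> ru; rewrite /act linvK; case E: (del a u) => [v|] /=.
  have [_] := red_del ru E; case: (del _ v) => // _.
  exact/treq_sym/del_treq.
by rewrite eqxx.
Qed.

Lemma act_comm a b u : ind a b -> treq (act a (act b u)) (act b (act a u)).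
Proof.
(* The mixed case: the inverse of [c] cancels and that of [d] does not. The latter cannot come to
   the front of [v] either, since it would then pass over the inverse of [c] in [r]. *)
have half c d r v : ind c d -> del (linv c) r = Some v ->
  del (linv d) r = None ->
    treq (act c (act d r)) (act d (act c r)).
  move=> cd Ec Ed; rewrite /act Ec Ed /= ind_neqV // indVl cd Ec /=.
  case E: (del (linv d) v) => [w|//].
  have [|r' E' _] := @treq_del (linv d) r (linv c :: w);
    last by rewrite E' in Ed.
  apply: treq_trans (del_treq Ec) (treq_trans (treq_cons _ (del_treq E)) _).
  exact: treq_swap.
move=> ab; have ba : ind b a by rewrite ind_sym.
case Ea: (del (linv a) u) => [v|]; case Eb: (del (linv b) u) => [w|].
- have [v' + h] := treq_del (treq_trans (treq_sym (del_treq Eb)) (del_treq Ea)).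
  rewrite /= (_ : linv b == linv a = false); last first.
    by rewrite ind_neq // indVl indVr.
  rewrite indVl indVr ab; case E: (del _ w) => [r|//] [er].
  rewrite -er in h; rewrite /act Ea Eb E; have [v2 ->
    h2] := treq_del (treq_sym h).
  exact: treq_sym.
- exact: half ab Ea Eb.
- exact/treq_sym/(half _ _ _ _ ba Eb Ea).
- rewrite /act Ea Eb /= !ind_neqV // !indVl ab ba Ea Eb /=; exact: treq_swap.
Qed.

End Words.

(* Products may be elaborated along convertible but syntactically different
   inheritance paths, which lia would treat as distinct atoms. *)
Ltac glia :=
  match goal with S : set (Group.sort ?G) |- _ =>
    repeat match goal with
    | h : context [@mul ?M] |- _ =>
        lazymatch M with monoid_Group__to__monoid_Magma G => fail | _ =>
          change (@mul M) with (@mul (monoid_Group__to__monoid_Magma G)) in h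
        end
    | |- context [@mul ?M] =>
        lazymatch M with monoid_Group__to__monoid_Magma G => fail | _ =>
          change (@mul M) with (@mul (monoid_Group__to__monoid_Magma G))
        end
    | h : context [@monoid.inv ?M] |- _ =>
        lazymatch M with monoid_Group__to__monoid_BaseGroup G => fail | _ =>
          change (@monoid.inv M)
            with (@monoid.inv (monoid_Group__to__monoid_BaseGroup G)) in h
        end
    | |- context [@monoid.inv ?M] =>
        lazymatch M with monoid_Group__to__monoid_BaseGroup G => fail | _ =>
          change (@monoid.inv M)
            with (@monoid.inv (monoid_Group__to__monoid_BaseGroup G))
        end
    end
  end; lia.

(** * Length, reduced words and first letters of group elements *)

Section Group.
Variables (G : groupType) (S : set G) (GS : is_raag S).
Local Notation L := (set_type S * bool)%type.
Local Notation len := (len S).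
Local Notation sub := (sub S).
Implicit Types (a b s : L) (u v : seq L) (x y z : G).

Lemma eval_nf u : eval (nf u) = eval u.
Proof.
elim: u => //= a u IH; rewrite eval_cons -IH /act.
case E: (del _ _) => [v|]; last by rewrite eval_cons.
by rewrite (treq_eval (del_treq E)) eval_cons letterV mulVKg.
Qed.

Lemma raag_eq_nf u v : raag_eq u v -> treq (nf u) (nf v).
Proof.
elim=> {u v} [u v [w r s b|w r s t st cst]|u|u v _|u v w _ + _].
- rewrite /nf !foldr_cat; apply: foldr_act_treq => /=.
  have -> : (s, b) = linv (s, ~~ b) :> L by rewrite /linv /= negbK.
  by rewrite -{2}[(s, ~~ b)]linvK; apply/act_inv/nf_red.
- rewrite /nf !foldr_cat; apply: foldr_act_treq => /=.
  by apply: act_comm; rewrite /ind /= cst eqxx andbT; apply/eqP.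
- exact: treq_refl.
- exact: treq_sym.
- exact: treq_trans.
Qed.

(** The presentation of [G] enters here. *)
Lemma eval_eq_nf u v : eval u = eval v -> treq (nf u) (nf v).
Proof. by move/(raag_presented GS u v)/raag_eq_nf. Qed.

Lemma del_size a u v : del a u = Some v -> size u = (size v).+1.
Proof. by move/del_treq/treq_size. Qed.

Lemma size_nf u : (size (nf u) <= size u)%N.
Proof.
elim: u => //= a u IH; rewrite /act; case E: (del _ _) => [v|] //=.
by move: IH; rewrite (del_size E); lia.
Qed.

Lemma len_eval u : len (eval u) = size (nf u).
Proof.
have P v : eval v = eval u -> (size (nf u) <= size v)%N.
  by move/eval_eq_nf/treq_size <-; apply: size_nf.
apply: xget_unique; first by split=> //; exists (nf u); rewrite eval_nf.
move=> n [[v [ev sv]] h]; apply/eqP; rewrite eqn_leq -{2}sv P // andbT.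
exact/h/eval_nf.
Qed.

Lemma nf_id u : red u -> nf u = u.
Proof.
by elim: u => //= a u IH /andP[na /IH ->]; rewrite /act; case: (del _ _) na.
Qed.

Lemma redE u : red u = (len (eval u) == size u).
Proof.
rewrite len_eval; apply/idP/eqP=> [/nf_id -> //|].
elim: u => //= a u IH; rewrite /act; have:= size_nf u.
case E: (del _ (nf u)) => [v|] /= h.
  by move: h; rewrite (del_size E); lia.
by case=> /IH ru; rewrite ru andbT -(nf_id ru) E.
Qed.

Lemma red_len u : red u -> len (eval u) = size u.
Proof. by rewrite redE => /eqP. Qed.

(** An arbitrary reduced word of [x]; by [red_treq] it is unique up to [treq], so its set of letters
    and its first letters depend on [x] alone. *)
Definition rd x : seq L := nf (projT1 (cid (raag_generated GS x))).

Lemma rdK x : eval (rd x) = x.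
Proof. by rewrite eval_nf; case: cid. Qed.

Lemma red_rd x : red (rd x). Proof. exact: nf_red. Qed.

Lemma size_rd x : size (rd x) = len x.
Proof. by rewrite -{2}(rdK x) red_len ?red_rd. Qed.

Lemma red_treq u v : red u -> red v -> eval u = eval v -> treq u v.
Proof. by move=> /nf_id {2}<- /nf_id {2}<- /eval_eq_nf. Qed.

Lemma treq_rd u : red u -> treq (rd (eval u)) u.
Proof. by move=> ru; apply: red_treq; rewrite ?red_rd ?rdK. Qed.

Lemma len_leq u : (len (eval u) <= size u)%N.
Proof. by rewrite len_eval size_nf. Qed.

Lemma len1 : len 1 = 0%N.
Proof. by rewrite -(eval_nil S) red_len. Qed.

Lemma len_eq0 x : (len x == 0%N) = (x == 1).
Proof.
apply/eqP/eqP => [|->]; last exact: len1.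
by rewrite -size_rd => /size0nil e; rewrite -(rdK x) e eval_nil.
Qed.

Lemma len_letter a : len (letter a) = 1%N.
Proof. by rewrite -eval_seq1 red_len. Qed.

Lemma lenV x : len x^-1 = len x.
Proof.
suff h y : (len y^-1 <= len y)%N by have := h x; have := h x^-1;
  rewrite invgK; lia.
by rewrite -{1}(rdK y) -eval_winv (leq_trans (len_leq _)) // size_winv size_rd.
Qed.

Lemma lenM x y : (len (x * y) <= len x + len y)%N.
Proof.
rewrite -{1}(rdK x) -{1}(rdK y) -eval_cat (leq_trans (len_leq _)) //.
by rewrite size_cat !size_rd.
Qed.

Lemma red_winv u : red (winv u) = red u.
Proof. by rewrite !redE eval_winv lenV size_winv. Qed.

(* Some reduced word of x starts with a. *)
Definition first a x : bool := (len ((letter a)^-1 * x) < len x)%N.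

Lemma len_letterVM a u : red u ->
  len ((letter a)^-1 * eval u) = if del a u then (size u).-1 else (size u).+1.
Proof.
move=> ru; rewrite -letterV -eval_cons len_eval /= (nf_id ru) /act linvK.
by case E: (del a u) => [v|] //=; rewrite (del_size E).
Qed.

Lemma first_eval a u : red u -> first a (eval u) = del a u.
Proof.
move=> ru; rewrite /first len_letterVM // red_len //.
case E: (del a u) => [v|] /=; last by apply/negbTE; lia.
by rewrite (del_size E) ltnSn.
Qed.

Lemma first_rd a x : first a x = del a (rd x).
Proof. by rewrite -first_eval ?red_rd ?rdK. Qed.

Lemma len_first a x : first a x -> len x = (len ((letter a)^-1 * x)).+1.
Proof.
move=> f; rewrite -(rdK x) len_letterVM ?red_rd // red_len ?red_rd //.
by rewrite -first_rd f; move: f; rewrite /first -(size_rd x); lia.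
Qed.

Lemma len_Nfirst a x : ~~ first a x -> len ((letter a)^-1 * x) = (len x).+1.
Proof.
move=> f; rewrite -(rdK x) len_letterVM ?red_rd // red_len ?red_rd //.
by rewrite -first_rd (negbTE f).
Qed.

Lemma first1 a : first a 1 = false.
Proof. by rewrite /first len1; apply/negbTE; lia. Qed.

Lemma first_ex x : x <> 1 -> exists a, first a x.
Proof.
move=> x1; case E: (rd x) => [|a u].
  by case: x1; rewrite -(rdK x) E eval_nil.
by exists a; rewrite first_rd E /= eqxx.
Qed.

Lemma first_ind a b x : first a x -> first b x -> a != b -> ind a b.
Proof.
rewrite !first_rd; elim: (rd x) => //= c u IH.
case: (c =P a) => [<-|_]; case: (c =P b) => [<-|_] //.
- by rewrite [ind c b]ind_sym; case: (ind b c).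
- by case: (ind a c).
- case: (ind a c) => //; case: (ind b c) => //.
  by case: (del a u) IH => //; case: (del b u).
Qed.

Lemma first_linv a x : first a x -> ~~ first (linv a) x.
Proof.
move=> fa; apply/negP => /(first_ind fa).
by rewrite neq_linv indVr ind_irr => /(_ isT).
Qed.

Lemma first_letterM a x : first a (letter a * x) = ~~ first (linv a) x.
Proof.
rewrite {1}/first mulKg; apply/idP/idP; last first.
  by move/len_Nfirst; rewrite letterV invgK => ->.
by apply: contraL => /len_first; rewrite letterV invgK => ->; glia.
Qed.

(** * Support *)

(* a commutes with, and differs from, every letter of x and its inverse. *)
Definition indx a x : bool := all (ind a) (rd x).

Lemma indx_red a u : red u -> indx a (eval u) = all (ind a) u.
Proof. by move=> ru; apply/eq_all_r/treq_mem/treq_rd. Qed.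

(** Normalization only removes letters, so even a word that is not reduced bounds the support of its
    value. *)
Lemma indx_eval a u : all (ind a) u -> indx a (eval u).
Proof.
move=> h; rewrite -eval_nf indx_red ?nf_red //.
elim: u h => //= b u IH /andP[ab /IH {}IH]; rewrite /act.
case E: (del _ _) => [v|] /=; last by rewrite ab.
by move: IH; rewrite (eq_all_r (treq_mem (del_treq E))) => /andP[].
Qed.

Lemma indx1 a : indx a 1.
Proof. by rewrite -(eval_nil S) indx_eval. Qed.

Lemma indx_letter a b : indx a (letter b) = ind a b.
Proof. by rewrite -eval_seq1 indx_red //= andbT. Qed.

Lemma indxM a x y : indx a x -> indx a y -> indx a (x * y).
Proof.
move=> hx hy; rewrite -(rdK x) -(rdK y) -eval_cat indx_eval // all_cat.
exact/andP.
Qed.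

Lemma indxV a x : indx a x^-1 = indx a x.
Proof.
by rewrite -{1}(rdK x) -eval_winv indx_red ?red_winv ?red_rd // all_ind_winv.
Qed.

Lemma indxX a x n : indx a x -> indx a (x ^+ n).
Proof.
by move=> hx; elim: n => [|n IH]; rewrite ?indx1 // expgS indxM.
Qed.

Lemma indx_commute a x : indx a x -> commute (letter a) x.
Proof. by move/all_ind_commute; rewrite rdK. Qed.

Lemma indx_linv a x : indx (linv a) x = indx a x. Proof. by []. Qed.

Lemma first_indx a b x : indx a x -> first b x -> ind a b.
Proof. by move=> /allP h; rewrite first_rd => /del_mem /h. Qed.

(** * Reduced products *)

(* There is no cancellation in the product x y. *)
Definition radd x y : bool := len (x * y) == (len x + len y)%N.

Lemma sub_radd x y : sub x y <-> radd x (x^-1 * y).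
Proof.
by rewrite /radd /Defs.sub mulVKg; split=> [->|/eqP].
Qed.

Lemma sub_mulr x y : sub x (x * y) <-> radd x y.
Proof. by rewrite sub_radd mulKg. Qed.

Lemma radd_red x y : radd x y = red (rd x ++ rd y).
Proof. by rewrite redE eval_cat !rdK size_cat !size_rd. Qed.

Lemma raddV x y : radd x y = radd y^-1 x^-1.
Proof. by rewrite /radd -invgM !lenV addnC. Qed.

(** Both sides say that the length of [x * y * z] is the sum of the three lengths. *)
Lemma raddA x y z : radd x y && radd (x * y) z = radd y z && radd x (y * z).
Proof.
rewrite /radd -mulgA; have := lenM x (y * z); have := lenM y z.
have := lenM x y; have := lenM (x * y) z; rewrite -mulgA.
move=> h1 h2 h3 h4; apply/idP/idP => /andP[/eqP e1 /eqP e2];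
  apply/andP; split; apply/eqP; glia.
Qed.

Lemma radd1l x : radd 1 x. Proof. by rewrite /radd len1 mul1g. Qed.

Lemma radd1r x : radd x 1. Proof. by rewrite /radd len1 mulg1 addn0. Qed.

Lemma first_mul a x y : radd x y ->
  first a (x * y) = first a x || indx a x && first a y.
Proof.
rewrite radd_red => h; rewrite -{1}(rdK x) -{1}(rdK y) -eval_cat first_eval //.
by rewrite del_cat -!first_rd.
Qed.

Lemma indx_mul a x y : radd x y -> indx a (x * y) = indx a x && indx a y.
Proof.
rewrite radd_red => h; rewrite -{1}(rdK x) -{1}(rdK y) -eval_cat indx_red //.
exact: all_cat.
Qed.

Lemma radd_letter a x : radd (letter a) x = ~~ first (linv a) x.
Proof.
rewrite /radd len_letter; case: (boolP (first _ x)) => /= h.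
  by have := len_first h; rewrite letterV invgK => ->; apply/negbTE/eqP; glia.
by have := len_Nfirst h; rewrite letterV invgK => ->; rewrite add1n eqxx.
Qed.

Lemma first_letter a b : first a (letter b) = (b == a).
Proof.
rewrite -eval_seq1 first_eval //=; case: eqP => // _; by case: (ind a b).
Qed.

Lemma first_sub a x : first a x <-> sub (letter a) x.
Proof. by rewrite sub_radd radd_letter -first_letterM mulVKg. Qed.

(** Reducedness is decided at the junction. Induction on a reduced word [a :: u] of [x]: if only the
    head [a] spoils the product, its inverse is first in [y] and passes over [u], so it is already
    first in [x^-1]. *)
Lemma raddP x y : reflect (forall a, first a x^-1 -> ~~ first a y) (radd x y).
Proof.
apply: (iffP idP) => [/eqP h a f1|].
  apply/negP => f2; have := lenM (x * letter a) ((letter a)^-1 * y).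
  rewrite mulgA mulgK -(lenV (x * letter a)) invgM.
  have := len_first f1; have := len_first f2; have := lenV x; glia.
have: red (rd x) by apply: red_rd.
rewrite -{2 3}(rdK x); elim: (rd x) => [|a u IH];
  first by rewrite eval_nil radd1l.
move=> /[dup] rau /= /andP[na ru]; rewrite eval_cons => h.
have ra : radd (letter a) (eval u) by rewrite radd_letter first_eval.
have fV b : first b (eval u)^-1 -> first b (letter a * eval u)^-1.
  by move=> f; rewrite invgM first_mul ?f // -raddV.
have ruy : radd (eval u) y by apply: IH => // b /fV /h.
have := raddA (letter a) (eval u) y; rewrite ra ruy /= => ->.
rewrite radd_letter first_mul // first_eval // (negbTE na) /=.
apply/negP => /andP[iu fy].
suff /h/negP : first (linv a) (letter a * eval u)^-1 by [].
rewrite (indx_commute (a := a) iu) invgM -letterV first_letterM linvK.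
apply/negP => f; move: iu; rewrite indx_linv -indxV => iu.
by have := first_indx iu f; rewrite ind_irr.
Qed.

(** * The prefix order *)

Lemma sub1x x : sub 1 x.
Proof. by rewrite sub_radd radd1l. Qed.

Lemma subxx x : sub x x.
Proof. by rewrite sub_radd mulVg radd1r. Qed.

Lemma sub_len x y : sub x y -> (len x <= len y)%N.
Proof. by rewrite /Defs.sub => <-; rewrite leq_addr. Qed.

Lemma sub_len_eq x y : sub x y -> (len y <= len x)%N -> x = y.
Proof.
rewrite /Defs.sub => e h; suff : len (x^-1 * y) == 0%N.
  by rewrite len_eq0 => /eqP xy; rewrite -[y](mulVKg x) xy mulg1.
by apply/eqP; glia.
Qed.

Lemma sub_anti x y : sub x y -> sub y x -> x = y.
Proof. by move=> xy /sub_len; apply: sub_len_eq. Qed.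

Lemma sub_trans y x z : sub x y -> sub y z -> sub x z.
Proof.
rewrite !sub_radd => xy yz.
have:= raddA x (x^-1 * y) (y^-1 * z).
by rewrite mulVKg xy yz -mulgA mulVKg => /esym /andP[].
Qed.

Lemma subx1 x : sub x 1 -> x = 1.
Proof. by move=> h; apply: (sub_anti h (sub1x x)). Qed.

Lemma sub_mul2l z x y : radd z x -> radd z y -> sub (z * x) (z * y) <-> sub x y.
Proof.
rewrite /radd /Defs.sub invgM -!mulgA mulKg => /eqP -> /eqP ->.
by split=> h; glia.
Qed.

Lemma sub_mul2l_radd z x y : radd z y -> sub x y -> sub (z * x) (z * y).
Proof.
move=> zy; rewrite sub_radd => xy; apply/sub_mul2l => //;
  last by rewrite sub_radd.
by have:= raddA z x (x^-1 * y); rewrite xy mulVKg zy /= => /andP[].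
Qed.

Lemma radd_sub z x y : radd z y -> sub x y -> radd z x.
Proof.
move=> zy; rewrite sub_radd => xy.
by have:= raddA z x (x^-1 * y); rewrite xy mulVKg zy /= => /andP[].
Qed.

Lemma first_mono a x y : sub x y -> first a x -> first a y.
Proof. by rewrite !first_sub => h1 h2; apply: sub_trans h1. Qed.

Lemma indx_mono a x y : sub x y -> indx a y -> indx a x.
Proof. by rewrite sub_radd => h; rewrite -{1}(mulVKg x y) indx_mul // =>
  /andP[]. Qed.

(** An exchange property: in [z = x * (x^-1 * z)] the letter [a] must come from the second factor,
    hence it passes over all of [x]. *)
Lemma first_swap a x z : sub x z -> first a z -> ~~ first a x ->
  indx a x /\ sub (letter a * x) z.
Proof.
rewrite sub_radd => xz; rewrite -(mulVKg x z) first_mul // => /orP[-> //|].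
case/andP=> ix fy _; split=> //; rewrite (indx_commute ix).
by apply: sub_mul2l_radd => //; rewrite -first_sub.
Qed.

(** The combinatorial form of [meet x y = 1], by [glb1] and [glb_coprime]. *)
Definition coprime x y := forall a, first a x -> ~~ first a y.

Lemma glb1 x y : coprime x y -> is_glb S x y 1.
Proof.
move=> cxy; split; [exact: sub1x|exact: sub1x|move=> u ux uy].
have [-> | /eqP /first_ex [a au]] := eqVneq u 1; first exact: sub1x.
by case/negP: (cxy a (first_mono ux au)); apply: first_mono au.
Qed.

Lemma sub_letterM a x y : first a y -> sub x ((letter a)^-1 * y) ->
  sub (letter a * x) y.
Proof.
move=> fy xy; rewrite -(mulVKg (letter a) y); apply: sub_mul2l_radd => //.
by rewrite -sub_radd -first_sub.
Qed.

Lemma sub_letterVM a x y : first a x -> sub x y ->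
  sub ((letter a)^-1 * x) ((letter a)^-1 * y).
Proof.
move=> fx xy; have fy := first_mono xy fx.
by apply/(@sub_mul2l (letter a)); rewrite -?sub_radd -?first_sub ?mulVKg.
Qed.

Lemma radd_indx a x : indx a x -> radd x (letter a).
Proof.
move=> ax; apply/raddP=> b f; rewrite first_letter; apply/eqP=> e.
by move: ax; rewrite -indxV => /first_indx /(_ f); rewrite e ind_irr.
Qed.

Lemma glb_ex x y : exists z, is_glb S x y z.
Proof.
have [n] := ubnP (len x); elim: n x y => // n IH x y xn.
have [[a [fx fy]]|h] := pselect (exists a, first a x /\ first a y); last first.
  exists 1; apply: glb1 => a fx; apply/negP => fy.
  by apply: h; exists a; rewrite fx.
have [|g [gx gy gP]] := IH ((letter a)^-1 * x) ((letter a)^-1 * y).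
  by move: xn; rewrite (len_first fx); glia.
exists (letter a * g); split; [exact: sub_letterM|exact: sub_letterM|].
have rag : radd (letter a) g.
  by apply: radd_sub gx; rewrite -sub_radd -first_sub.
move=> u ux uy; have [fu|fu] := boolP (first a u).
  rewrite -(mulVKg (letter a) u); apply: sub_mul2l_radd => //.
  by apply: gP; apply: sub_letterVM.
(* A lower bound [u] missing the common first letter [a] lies below [a * u], which by exchange is
   again a lower bound and falls under the previous case. *)
have [iu aux] := first_swap ux fx fu; have [_ auy] := first_swap uy fy fu.
have fau : first a (letter a * u).
  rewrite first_letterM; apply/negP => /(first_mono ux).
  exact/negP/first_linv.
apply: (@sub_trans (letter a * u)).
  by rewrite (indx_commute iu) sub_mulr radd_indx.
apply: sub_mul2l_radd => //; rewrite -(mulKg (letter a) u).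
by apply: gP; apply: sub_letterVM.
Qed.

Lemma glb_uniq x y z z' : is_glb S x y z -> is_glb S x y z' -> z = z'.
Proof.
by case=> zx zy zP [zx' zy' zP']; apply: sub_anti; [apply: zP'|apply: zP].
Qed.

Lemma meetE x y z : is_glb S x y z -> meet S x y = z.
Proof. by move=> zP; apply: xget_unique => // t /glb_uniq; apply. Qed.

Lemma meetP x y : is_glb S x y (meet S x y).
Proof. by have [z /[dup] zP /meetE ->] := glb_ex x y. Qed.

Lemma glb_coprime x y : is_glb S x y 1 -> coprime x y.
Proof.
case=> _ _ h a; rewrite !first_sub => ax; apply/negP; rewrite first_sub => ay.
have /subx1 e := h _ ax ay; have := len_letter a.
by rewrite e len1.
Qed.

Lemma glb_mul z x y : radd z x -> radd z y -> coprime x y ->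
  is_glb S (z * x) (z * y) z.
Proof.
move=> zx zy cxy; have := meetP (z * x) (z * y); set g := meet S _ _ => gP.
suff e : g = z by rewrite e in gP.
case: gP => gx gy gP; have zg : sub z g by apply: gP; rewrite sub_mulr.
have rzg : radd z (z^-1 * g) by rewrite -sub_radd.
suff z1 : z^-1 * g = 1 by rewrite -[g](mulVKg z) z1 mulg1.
by apply: subx1; have [_ _] := glb1 cxy; apply; apply/(@sub_mul2l z) => //;
  rewrite mulVKg.
Qed.

(** * Orthogonality *)

(** Disjoint, elementwise commuting supports; [orthogonalP] matches this with the lattice notion. *)
Definition ortho x y := all (fun a => indx a y) (rd x).

Lemma orthoP x y : reflect (forall a, a \in rd x -> indx a y) (ortho x y).
Proof. exact: allP. Qed.

Lemma ortho_sym x y : ortho x y -> ortho y x.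
Proof.
move=> /orthoP h; apply/orthoP => b yb; apply/allP => a xa.
by rewrite ind_sym; apply: (allP (h a xa)).
Qed.

Lemma orthoMr x y z : ortho x y -> ortho x z -> ortho x (y * z).
Proof.
by move=> /orthoP h /orthoP h'; apply/orthoP => a ax; rewrite indxM ?h ?h'.
Qed.

Lemma ortho1r x : ortho x 1.
Proof. by apply/orthoP => a _; apply: indx1. Qed.

Lemma orthoXr x y n : ortho x y -> ortho x (y ^+ n).
Proof.
by move=> h; elim: n => [|n IH]; rewrite ?ortho1r // expgS orthoMr.
Qed.

Lemma orthoVr x y : ortho x y^-1 = ortho x y.
Proof. by apply: eq_all => a; rewrite indxV. Qed.

Lemma orthoVl x y : ortho x^-1 y = ortho x y.
Proof.
by apply/idP/idP => /ortho_sym h; apply/ortho_sym; move: h; rewrite orthoVr.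
Qed.

Lemma ortho_letter a x : ortho (letter a) x = indx a x.
Proof.
rewrite /ortho -eval_seq1 (eq_all_r (treq_mem (treq_rd _))) //=.
by rewrite andbT.
Qed.

Lemma ortho_commute x y : ortho x y -> commute x y.
Proof.
rewrite /ortho -{2}(rdK x); elim: (rd x) => [|a u IH] /=.
  by rewrite eval_nil => _; apply/commute_sym/commute1.
case/andP=> /indx_commute ay /IH uy; rewrite eval_cons.
exact/commute_sym/commuteM/commute_sym/uy/commute_sym.
Qed.

Lemma first_mem a x : first a x -> a \in rd x.
Proof. by rewrite first_rd => /del_mem. Qed.

Lemma ortho_coprime x y : ortho x y -> coprime x y.
Proof.
move=> /orthoP h a /first_mem /h ay; apply/negP => /(first_indx ay).
by rewrite ind_irr.
Qed.

Lemma ortho_radd x y : ortho x y -> radd x y.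
Proof. by rewrite -orthoVl => /ortho_coprime h; apply/raddP. Qed.

Lemma ortho_mono x y z : sub x y -> ortho y z -> ortho x z.
Proof.
move=> xy /ortho_sym /orthoP h; apply/ortho_sym/orthoP => a /h.
exact: indx_mono.
Qed.

(** The head [a] of a reduced word of [y] is first in [z] but not in [x], so it passes over [x] by
    exchange, and one can divide by [a]. *)
Lemma coprime_bounded x y z : coprime x y -> sub x z -> sub y z ->
  ortho x y /\ sub (x * y) z.
Proof.
have : red (rd y) by apply: red_rd.
rewrite -{2 3 4 5}(rdK y); elim: (rd y) x z => [|a u IH] x z.
  by rewrite eval_nil mulg1 ortho1r.
move=> /= /andP[na ru]; rewrite eval_cons => cxy xz yz.
have rau : radd (letter a) (eval u) by rewrite radd_letter first_eval.
have fa : first a (letter a * eval u) by rewrite first_letterM first_eval.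
have nax : ~~ first a x by apply/negP => /cxy; rewrite fa.
have fz := first_mono yz fa.
have [ax axz] := first_swap xz fz nax.
have faxx : first a (letter a * x).
  rewrite first_letterM; apply/negP => /(first_mono xz).
  exact/negP/first_linv.
have := sub_letterVM faxx axz; have := sub_letterVM fa yz; rewrite !mulKg.
move=> uz xz'; have [] := IH x ((letter a)^-1 * z) ru _ xz' uz.
  (* A first letter [b] of [x] is independent of [a], so if it were first in [eval u] it would be
     first in [y]. *)
  move=> b fx; apply/negP => fu; move: (cxy b fx).
  by rewrite first_mul // fu andbT indx_letter ind_sym (first_indx ax fx) orbT.
move=> oxu xuz; split.
  by apply: orthoMr => //; apply/ortho_sym; rewrite ortho_letter.
by rewrite mulgA -(indx_commute ax) -mulgA; apply: sub_letterM.
Qed.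

Lemma orthogonalP x y : orthogonal S x y <-> ortho x y.
Proof.
split=> [[m1 [z [xz yz _]]]|oxy].
  have := meetP x y; rewrite m1 => /glb_coprime c.
  by have [] := coprime_bounded c xz yz.
have c := ortho_coprime oxy; split; first exact/meetE/glb1.
exists (x * y); split; first by rewrite sub_mulr ortho_radd.
  by rewrite (ortho_commute oxy) sub_mulr; apply/ortho_radd/ortho_sym.
by move=> u xu yu; have [] := coprime_bounded c xu yu.
Qed.

(** * Conjugation *)

Lemma conjg_letter x s : x ^ letter s = letter (linv s) * x * letter s.
Proof. by rewrite letterV /conjg mulgA. Qed.

Lemma conjg_linv x s : (x ^ letter s) ^ letter (linv s) = x.
Proof. by rewrite letterV conjgK. Qed.

(* Conjugation by s lengthens x at both ends. *)
Definition long s x := radd (letter (linv s)) x && radd (letter (linv s) * x)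
  (letter s).

Lemma len_conj_le s x : (len (x ^ letter s) <= len x + 2)%N.
Proof.
rewrite conjg_letter; have := lenM (letter (linv s) * x) (letter s).
by have := lenM (letter (linv s)) x; rewrite !len_letter; glia.
Qed.

Lemma longE s x : long s x = (len (x ^ letter s) == len x + 2)%N.
Proof.
rewrite conjg_letter /long /radd !len_letter.
have := lenM (letter (linv s) * x) (letter s).
have := lenM (letter (linv s)) x; rewrite !len_letter.
by move=> h1 h2; apply/andP/eqP => [[/eqP e1 /eqP e2]|e];
  [glia | split; apply/eqP; glia].
Qed.

Lemma longV s x : long s x^-1 = long s x.
Proof. by rewrite !longE conjVg !lenV. Qed.

(** The only cancellation left in [s^-1 * x * s] is between the two outer letters, and for that [s]
    has to pass over all of [x]. *)
Lemma longP s x : ~~ first s x -> ~~ first s x^-1 -> long s x || indx s x.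
Proof.
move=> f1 f2; rewrite /long radd_letter linvK f1 /=.
rewrite raddV -letterV radd_letter linvK invgM letterV invgK first_mul.
  by rewrite (negbTE f2) first_letter eqxx andbT indxV; case: (indx s x).
by rewrite raddV invgK -letterV radd_letter linvK.
Qed.

(** The final [s] never comes to the front, being blocked by the initial inverse of [s]. *)
Lemma first_long s x b : long s x ->
  first b (x ^ letter s) = (b == linv s) || ind s b && first b x.
Proof.
rewrite conjg_letter => /andP[h1 h2].
rewrite !first_mul // !first_letter indx_letter indVr (eq_sym _ b).
case: eqP => //= bs; rewrite indx_mul // indx_letter indVr ind_sym.
by case sb: (ind s b); rewrite //= [s == b]eq_sym (ind_neq sb) !andbF orbF.
Qed.

Lemma long_first s x : long s x -> ~~ first s x /\ ~~ first s x^-1.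
Proof.
have f y : long s y -> ~~ first s y by case/andP; rewrite radd_letter linvK.
by move=> h; split; apply: f; rewrite ?longV.
Qed.

Lemma first_both s x : first s x -> first s x^-1 ->
  long (linv s) (x ^ letter s).
Proof.
move=> f1 f2; rewrite longE conjg_linv (len_first f1).
set z := _^-1 * x; have xz : x = letter s * z by rewrite mulVKg.
have rz : radd (letter s) z by rewrite /z -sub_radd -first_sub.
have zV : first s z^-1.
  move: f2; rewrite xz invgM -letterV first_mul; last by rewrite letterV -raddV.
  by rewrite first_letter linv_neq andbF orbF.
have := len_first zV; rewrite lenV.
have -> : x ^ letter s = ((letter s)^-1 * z^-1)^-1.
  by rewrite conjg_letter letterV -mulgA xz !invgM !invgK !mulgA mulVg mul1g.
by rewrite lenV => ->; apply/eqP; glia.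
Qed.

Definition firsts (I : Type) (P : I -> G) x :=
  forall b, first b x <-> exists i, first b (P i).

(** As [s] stands at neither end of [W], it stands at neither end of any [P i], so each factor is
    lengthened or fixed. The factor [P i0] is lengthened and accounts for the new first letter
    [linv s]. *)
Lemma firsts_conj (I : Type) (P : I -> G) W s :
  long s W -> (exists i, ~~ indx s (P i)) ->
  firsts P W -> firsts (fun i => (P i)^-1) W^-1 ->
  firsts (fun i => P i ^ letter s) (W ^ letter s).
Proof.
move=> lW [i0 ni0] F FV b.
have [nW nWV] := long_first lW.
have lP i : long s (P i) || indx s (P i).
  apply: longP; [apply: contra nW => f; apply/F|apply: contra nWV => f;
    apply/FV];
  by exists i.
have P0 : long s (P i0) by have := lP i0; rewrite (negbTE ni0) orbF.
rewrite first_long //; split=> [/orP[/eqP ->|/andP[sb /F [i fi]]]|[i]].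
- by exists i0; rewrite first_long // eqxx.
- exists i; case/orP: (lP i) => h; first by rewrite first_long // sb fi orbT.
  by rewrite /conjg -(indx_commute h) mulKg.
- case/orP: (lP i) => h.
    rewrite first_long // => /orP[-> //|/andP[-> fi]].
    by rewrite (_ : first b W) ?orbT //; apply/F; exists i.
  rewrite /conjg -(indx_commute h) mulKg => fi.
  by rewrite (first_indx h fi) (_ : first b W) ?orbT //; apply/F; exists i.
Qed.

Lemma eval_rcons u a : eval (rcons u a) = eval u * letter a.
Proof. by rewrite -cats1 eval_cat eval_seq1. Qed.

Lemma len_conj_word u x : (len (x ^ eval u) <= len x + 2 * size u)%N.
Proof.
elim/last_ind: u => [|u a IH]; first by rewrite eval_nil conjg1 addn0.
rewrite eval_rcons conjgM size_rcons; have := len_conj_le a (x ^ eval u); glia.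
Qed.

Lemma conjg_fixE x y : commute x y <-> x ^ y = x.
Proof. by rewrite /commute conjgC; split=> [/mulgI //|->]; rewrite // -conjgC.
  Qed.

Lemma firsts_conj_word (I : Type) (P : I -> G) W u :
  len (W ^ eval u) = (len W + 2 * size u)%N ->
  (forall g, (forall i, commute (P i) g) -> commute W g) ->
  firsts P W -> firsts (fun i => (P i)^-1) W^-1 ->
  firsts (fun i => P i ^ eval u) (W ^ eval u) /\
  firsts (fun i => (P i ^ eval u)^-1) (W ^ eval u)^-1.
Proof.
move=> + cW F FV; elim/last_ind: u => [_|u a IH].
  rewrite eval_nil conjg1.
  rewrite (_ : (fun i => P i ^ 1) = P); last by apply: funext => i;
    rewrite conjg1.
  by rewrite (_ : (fun i => _) = fun i => (P i)^-1) //; apply: funext => i;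
    rewrite conjg1.
rewrite eval_rcons conjgM size_rcons => e.
have l1 := len_conj_le a (W ^ eval u); have l2 := len_conj_word u W.
have [|{}F {}FV] := IH; first by glia.
have lo : long a (W ^ eval u) by rewrite longE; apply/eqP; glia.
(* Otherwise the letter [a], conjugated back by [eval u], centralizes all factors, hence [W],
   against the growth in length. *)
have [i ni] : exists i, ~~ indx a (P i ^ eval u).
  apply: contrapT => h.
  suff e' : (W ^ eval u) ^ letter a = W ^ eval u by rewrite e' in e; glia.
  rewrite -conjgM [eval u * _]conjgCV conjgM; congr (_ ^ _).
  apply/conjg_fixE/cW => i.
  apply/conjg_fixE/(@conjg_inj _ (eval u)); rewrite -conjgM -conjgCV conjgM.
  apply/conjg_fixE/commute_sym/indx_commute/negPn/negP => ni.
  by apply: h; exists i.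
rewrite (_ : (fun i => P i ^ _) = fun i => (P i ^ eval u) ^ letter a);
  last first.
  by apply: funext => j; rewrite conjgM.
rewrite (_ : (fun i => _^-1) = fun i => (P i ^ eval u)^-1 ^ letter a);
  last first.
  by apply: funext => j; rewrite conjgM conjVg.
split; first by apply: firsts_conj => //; exists i.
rewrite -conjVg; apply: firsts_conj; rewrite ?longV ?invgK //.
  by exists i; rewrite indxV.
by rewrite (_ : (fun i => _) = fun i => P i ^ eval u) //; apply: funext => j;
  rewrite invgK.
Qed.

(** * Cyclically reduced elements and powers *)

Definition cycred x := coprime x x^-1.

Lemma cycredV x : cycred x -> cycred x^-1.
Proof.
by move=> cx a fV; rewrite invgK; apply/negP => /cx; rewrite fV.
Qed.

Lemma cycred_ex x :
  exists c u, [/\ x = c ^ eval u, cycred c & len x = (len c + 2 * size u)%N].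
Proof.
have [n] := ubnP (len x); elim: n x => // n IH x xn.
have [[s [f1 f2]]|h] := pselect (exists s, first s x /\ first s x^-1);
  last first.
  exists x, [::]; rewrite eval_nil conjg1 addn0; split=> // a f1;
    apply/negP=> f2.
  by apply: h; exists a.
have := first_both f1 f2; rewrite longE conjg_linv => /eqP e.
have [|c [u [xc cc lc]]] := IH (x ^ letter s); first by glia.
exists c, (rcons u (linv s)); split=> //; last by rewrite size_rcons; glia.
by rewrite eval_rcons conjgM -xc conjg_linv.
Qed.

(** The two claims feed each other: knowing the first letters of a power makes the next product
    reduced. The exponent is shifted because [c ^+ 0] has no first letters. *)
Lemma cycred_radd_first c m : cycred c ->
  radd c (c ^+ m) /\ forall b, first b (c ^+ m.+1) = first b c.
Proof.
move=> cc; elim: m => [|m [IHr IHf]].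
  by rewrite radd1r; split=> // b; rewrite expg1.
have r : radd c (c ^+ m.+1).
  by apply/raddP => a f; rewrite IHf; apply/negP => /cc; rewrite f.
split=> // b; rewrite expgS first_mul // IHf.
by case: (first b c) => //=; rewrite andbF.
Qed.

Lemma cycred_radd c m : cycred c -> radd c (c ^+ m).
Proof. by move=> cc; have [] := cycred_radd_first m cc. Qed.

Lemma cycred_first c m b : cycred c -> first b (c ^+ m.+1) = first b c.
Proof. by move=> cc; have [] := cycred_radd_first m cc. Qed.

Lemma cycred_indx c m b : cycred c -> indx b (c ^+ m.+1) = indx b c.
Proof.
move=> cc; rewrite expgS indx_mul ?cycred_radd //.
by case bc: (indx b c) => //=; rewrite indxX.
Qed.

Lemma len_conjE x g : (len (x ^ g) == len x + 2 * len g)%N =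
  [&& radd g^-1 x, radd x g & radd g^-1 (x * g)].
Proof.
rewrite /conjg /radd !lenV; have := lenM x g; have := lenM g^-1 (x * g).
have := lenM g^-1 x; have := lenM (g^-1 * x) g; rewrite !lenV -!mulgA.
move=> h1 h2 h3 h4; apply/eqP/and3P => [e|[/eqP e1 /eqP e2 /eqP e3]]; last glia.
by split; apply/eqP; glia.
Qed.

(** Whether conjugation by [g] is reduced depends only on the letters at both ends and on the
    letters independent of the element, which a cyclically reduced element shares with its positive
    powers. *)
Lemma len_conj_same x y g :
  (forall b, first b x = first b y) -> (forall b, first b x^-1 = first b y^-1)
    ->
  (forall b, indx b x = indx b y) ->
  len (x ^ g) = (len x + 2 * len g)%N -> len (y ^ g) = (len y + 2 * len g)%N.
Proof.
move=> f fV i /eqP; rewrite len_conjE => /and3P[h1 h2 h3]; apply/eqP.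
have h2' : radd y g by apply/raddP => a; rewrite -fV; apply/raddP.
rewrite len_conjE h2'; apply/and3P; split=> //; apply/raddP => a.
  by rewrite -f; apply/raddP.
by move/raddP: h3 => /(_ a); rewrite !first_mul // f i.
Qed.

Lemma len_conj_eval x u : (len (x ^ eval u) = len x + 2 * size u)%N -> red u.
Proof.
move=> e; rewrite redE eqn_leq len_leq /=.
have := lenM (eval u)^-1 (x * eval u); have := lenM x (eval u).
move: e; rewrite /conjg lenV; glia.
Qed.

(** With [x = c ^ eval u] and [c] cyclically reduced, [c ^+ m.+1] is treated as an element whose
    only factor is [c]. *)
Lemma first_exp x m b : first b (x ^+ m.+1) = first b x.
Proof.
have [c [u [-> cc lc]]] := cycred_ex x; rewrite -conjXg.
have ru := len_conj_eval lc; have luE := red_len ru.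
have F k (d : G) : cycred d -> firsts (fun _ : unit => d) (d ^+ k.+1).
  by move=> cd a; rewrite cycred_first //; split=> [|[]//]; exists tt.
have [||||Fu _] := @firsts_conj_word _ (fun _ : unit => c) (c ^+ m.+1) u.
- rewrite -luE; apply: (@len_conj_same c); rewrite ?luE // => a.
  + by rewrite cycred_first.
  + by rewrite -expVgn cycred_first //; apply: cycredV.
  + by rewrite cycred_indx.
- by move=> g /(_ tt) cg; apply/commute_sym/commuteX/commute_sym.
- exact: F.
- by rewrite -expVgn; apply/F/cycredV.
by apply/idP/idP => [/Fu[]//|h]; apply/Fu; exists tt.
Qed.

(** * Products of orthogonal families *)

Definition ortho_family n (q : 'I_n -> G) :=
  forall i j, i <> j -> ortho (q i) (q j).

Lemma ortho_prod n (q : 'I_n -> G) x :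
  (forall i, ortho x (q i)) -> ortho x (\prod_(i < n) q i).
Proof.
move=> h; apply: (big_ind (ortho x)) => [|y z|i _] //; first exact: ortho1r.
exact: orthoMr.
Qed.

Lemma ortho_family_lift n (q : 'I_n.+1 -> G) : ortho_family q ->
  ortho_family (fun i => q (lift ord0 i)) /\ ortho (q ord0) (\prod_(i < n) q
    (lift ord0 i)).
Proof.
move=> oq; split=> [i j ij|]; first by apply: oq => /lift_inj.
by apply: ortho_prod => i; apply: oq => e; have := neq_lift ord0 i;
  rewrite -e eqxx.
Qed.

Lemma first_prod n (q : 'I_n -> G) :
  ortho_family q -> firsts q (\prod_(i < n) q i).
Proof.
elim: n q => [|n IH] q oq b.
  by rewrite big_ord0 first1; split=> // -[[]].
have [oq' o0] := ortho_family_lift oq.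
rewrite big_ord_recl first_mul ?ortho_radd //; split.
  case/orP=> [f|/andP[_ /(IH _ oq')[i fi]]]; first by exists ord0.
  by exists (lift ord0 i).
case=> i; case: (unliftP ord0 i) => [j|] -> f; last by rewrite f.
have f' : first b (\prod_(i < n) q (lift ord0 i)).
  by apply/(IH _ oq'); exists j.
rewrite f' andbT; apply/orP; right.
by move/ortho_sym/orthoP: o0; apply; apply: first_mem.
Qed.

Lemma indx_prod n (q : 'I_n -> G) a : ortho_family q ->
  indx a (\prod_(i < n) q i) -> forall i, indx a (q i).
Proof.
elim: n q => [|n IH] q oq; first by move=> _ [].
have [oq' o0] := ortho_family_lift oq.
rewrite big_ord_recl indx_mul ?ortho_radd // => /andP[h0 h] i.
case: (unliftP ord0 i) => [j|] -> //; exact: (IH (fun i => q (lift ord0 i))).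
Qed.

Lemma prod_inv n (q : 'I_n -> G) : ortho_family q ->
  (\prod_(i < n) q i)^-1 = \prod_(i < n) (q i)^-1.
Proof.
elim: n q => [|n IH] q oq; first by rewrite !big_ord0 invg1.
have [oq' o0] := ortho_family_lift oq.
by rewrite !big_ord_recl (ortho_commute o0) invgM IH.
Qed.

Lemma ortho_familyX n (q : 'I_n -> G) (m : 'I_n -> nat) :
  ortho_family q -> ortho_family (fun i => q i ^+ m i).
Proof.
by move=> oq i j /oq h; apply/orthoXr/ortho_sym/orthoXr/ortho_sym.
Qed.

Lemma ortho_familyV n (q : 'I_n -> G) :
  ortho_family q -> ortho_family (fun i => (q i)^-1).
Proof. by move=> oq i j /oq; rewrite orthoVl orthoVr. Qed.

Lemma first_prodX n (q : 'I_n -> G) (m : 'I_n -> nat) :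
  ortho_family q -> (forall i, 0 < m i)%N ->
  firsts q (\prod_(i < n) q i ^+ m i).
Proof.
move=> oq m0 b; rewrite (first_prod (ortho_familyX m oq) b).
by split=> -[i fi]; exists i; move: fi; case: (m i) (m0 i) => // k _;
  rewrite first_exp.
Qed.

Lemma first_prodXV n (q : 'I_n -> G) (m : 'I_n -> nat) :
  ortho_family q -> (forall i, 0 < m i)%N ->
  firsts (fun i => (q i)^-1) (\prod_(i < n) q i ^+ m i)^-1.
Proof.
move=> oq m0; rewrite prod_inv; last exact: ortho_familyX.
rewrite (eq_bigr (fun i => (q i)^-1 ^+ m i)) => [|i _]; last by rewrite expVgn.
exact/first_prodX/m0/ortho_familyV.
Qed.

Lemma first_conj_prodX n (q : 'I_n -> G) (m : 'I_n -> nat) c u :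
  ortho_family q -> (forall i, 0 < m i)%N -> c = \prod_(i < n) q i ^+ m i ->
  len (c ^ eval u) = (len c + 2 * size u)%N ->
  firsts (fun i => q i ^ eval u) (c ^ eval u).
Proof.
move=> oq m0 cE lc; have [] // := @firsts_conj_word _ q c u lc.
- move=> g cg; rewrite cE; apply/commute_sym/commute_prod => i _.
  exact/commuteX/commute_sym.
- by rewrite cE; apply: first_prodX.
- by rewrite cE; apply: first_prodXV.
Qed.

(** * The set of cyclic reducers *)

Lemma len_conj_leq x g : (len (x ^ g) <= len x + 2 * len g)%N.
Proof. by rewrite -{1}(rdK g) -(size_rd g) len_conj_word. Qed.

(** If [a] were independent of [x], the shorter element [a^-1 * g] would give the same conjugate. *)
Lemma len_conj_indx x g a : len (x ^ g) = (len x + 2 * len g)%N ->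
  first a g -> ~~ indx a x.
Proof.
move=> e fa; apply/negP => ix; have := len_conj_leq x ((letter a)^-1 * g).
move: e; rewrite (len_first fa) -{1}(mulVKg (letter a) g) conjgM.
by rewrite (_ : x ^ letter a = x) => [->|];
  [glia | apply/conjg_fixE/commute_sym/indx_commute].
Qed.

Lemma phi_conj w g x : phi S w (g * x) = g * phi S (w ^ g) x.
Proof.
by rewrite /phi /median /conjg !invgM ?invgK -!mulgA ?mulVKg ?mulKg.
Qed.

Lemma phi_conj1 c g : cycred c -> len (c ^ g) = (len c + 2 * len g)%N ->
  phi S (c ^ g) 1 = g^-1.
Proof.
move=> cc e; have NC a := len_conj_indx (a := a) e.
have: (len (c^-1 ^ g) == len c^-1 + 2 * len g)%N by rewrite conjVg !lenV e.
have: (len (c ^ g) == len c + 2 * len g)%N by rewrite e.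
rewrite !len_conjE => /and3P[h1 h2 h3] /and3P[k1 k2 k3].
rewrite /phi /median !mulg1.
(* The meet is that of [(g^-1 * c^-1) * g] and [(g^-1 * c^-1) * (c^-1 * g)], the inverse of [c ^ g]
   and its square; the remainders [g] and [c^-1 * g] share no first letter. *)
rewrite (@meetE _ _ (g^-1 * c^-1)).
  by rewrite /conjg -!mulgA mulVKg mulgV mulg1.
have -> : (c ^ g)^-1 = (g^-1 * c^-1) * g by rewrite -conjVg /conjg mulgA.
have -> : (g^-1 * c^-1) * g * ((g^-1 * c^-1) * g) = (g^-1 * c^-1) * (c^-1 * g).
  by rewrite -!mulgA mulVKg.
apply: glb_mul.
- by have := raddA g^-1 c^-1 g; rewrite k1 k2 k3 => /andP[].
- apply/raddP => a; rewrite invgM !invgK !first_mul // indxV.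
  case/orP=> [fc|/andP[ic /NC]]; last by rewrite ic.
  rewrite negb_or; move: (cc a fc) => -> /=.
  apply/negP => /andP[ic _]; by have := first_indx ic fc; rewrite ind_irr.
- move=> a fg; rewrite first_mul // indxV (negbTE (NC a fg)) orbF.
  by move/raddP: k1; apply; rewrite invgK.
Qed.

(** If [w ^ x = c ^ g] is a reduced conjugation of a cyclically reduced [c], then [phi] sends [x] to
    [x * g^-1], which strips the conjugator. *)
Lemma XsetP w g : Xset S w g <-> cycred (w ^ g).
Proof.
split=> [[x _ <-]|cwg].
  have [c [u [wx cc lc]]] := cycred_ex (w ^ x); rewrite wx in lc.
  have lu := red_len (len_conj_eval lc).
  rewrite -(mulg1 x) phi_conj wx phi_conj1 ?lu //.
  by rewrite conjgM wx -conjgM mulgV conjg1.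
exists g => //; rewrite -{1}(mulg1 g) phi_conj -[w ^ g]conjg1 phi_conj1 //.
  by rewrite invg1 mulg1.
by rewrite conjg1 len1 muln0 addn0.
Qed.

(** * Orthogonality in different cyclic reductions *)

Lemma first_letterM_ind s a x : ind s a -> first a x -> first a (letter s * x).
Proof.
move=> sa fx; have ias : indx a (letter s) by rewrite indx_letter ind_sym.
have [f|f] := boolP (first (linv s) x).
  have -> : letter s = (letter (linv s))^-1 by rewrite letterV invgK.
  move: fx; rewrite -{1}(mulVKg (letter (linv s)) x) first_mul.
    by rewrite first_letter [_ == a]eq_sym ind_neqV //= => /andP[].
  by rewrite -sub_radd -first_sub.
by rewrite first_mul ?radd_letter // ias fx orbT.
Qed.

Lemma first_mulr s a x : a != linv s -> first a x -> first a (x * letter s).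
Proof.
move=> na fx; have [r|] := boolP (radd x (letter s)).
  by rewrite first_mul // fx.
rewrite raddV -letterV radd_letter linvK negbK => f.
have : radd (x * letter s) (letter (linv s)).
  by rewrite raddV invgM -!letterV linvK letterV -sub_radd -first_sub.
by move/(first_mul a); rewrite letterV mulgK fx -letterV first_letter
  [_ == a]eq_sym (negbTE na) andbF orbF.
Qed.

(** An obstruction survives each letter [s] of [g]: if [s] is independent of [t], then [t] stays at
    both ends; otherwise [s] lengthens [z], and its inverse takes over the role of [t]. *)
Lemma not_cycred_conj t z g :
  first t z -> first t z^-1 -> ~~ first t g -> ~ cycred (z ^ g).
Proof.
have : red (rd g) by apply: red_rd.
rewrite -{2 3}(rdK g); elim: (rd g) t z => [|s u IH] t z.
  by rewrite eval_nil conjg1 => _ f1 f2 _ /(_ t f1); rewrite f2.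
move=> /= /andP[ns ru]; rewrite eval_cons => f1 f2.
have r : radd (letter s) (eval u) by rewrite radd_letter first_eval.
rewrite first_mul // first_letter negb_or indx_letter conjgM => /andP[st].
have [sst|nst] := boolP (ind s t).
  have fs y : first t y -> first t (y ^ letter s).
    rewrite conjg_letter => fy; apply: first_mulr; first by rewrite ind_neqV.
    exact: first_letterM_ind.
  by rewrite ind_sym sst /= => fu; apply: (IH t) => //; rewrite -?conjVg fs.
move=> _; have ns1 : ~~ first s z.
  by apply: contra nst => f; apply: (first_ind f f1).
have ns2 : ~~ first s z^-1 by apply: contra nst => f; apply: (first_ind f f2).
case/orP: (longP ns1 ns2) => [lz|/first_indx /(_ f1)]; last by move=> h;
  rewrite h in nst.
apply: (IH (linv s)) => //.
- by rewrite first_long // eqxx.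
- by rewrite -conjVg first_long ?longV // eqxx.
- by rewrite first_eval.
Qed.

(** An obstruction [t] in the conjugate by [s] disappears both on going back to [c] and on going on
    to [c ^ g], so [t] is first in [s^-1] and in [s^-1 * g]; but [s] is first in [g]. *)
Lemma cycred_conj_letter c g s :
  cycred c -> cycred (c ^ g) -> first s g -> cycred (c ^ letter s).
Proof.
move=> cc cg fs t f1; apply/negP => f2.
have ft : first t (letter (linv s)).
  by apply/negPn/negP => /(not_cycred_conj f1 f2); rewrite conjg_linv.
have : first t ((letter s)^-1 * g).
  by apply/negPn/negP => /(not_cycred_conj f1 f2); rewrite -conjgM mulVKg.
move: ft; rewrite first_letter => /eqP <-; apply/negP.
rewrite -{1}(linvK s) -[(letter s)^-1]letterV -first_letterM.
by rewrite linvK letterV mulVKg.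
Qed.

Lemma cycred_factor n (q : 'I_n -> G) (m : 'I_n -> nat) c :
  ortho_family q -> (forall i, 0 < m i)%N -> c = \prod_(i < n) q i ^+ m i ->
  cycred c -> forall i, cycred (q i).
Proof.
move=> oq m0 cE cc i a f1; apply/negP => f2.
have /cc/negP : first a c by rewrite cE; apply/(first_prodX oq m0); exists i.
by apply; rewrite cE; apply/(first_prodXV oq m0); exists i.
Qed.

Lemma ortho_conj_letter n (q : 'I_n -> G) (m : 'I_n -> nat) c s :
  ortho_family q -> (forall i, 0 < m i)%N -> c = \prod_(i < n) q i ^+ m i ->
  cycred c -> cycred (c ^ letter s) -> ortho_family (fun i => q i ^ letter s).
Proof.
move=> oq m0 cE cc ccs.
(* At most one factor, named by [o], is not independent of [s]. If [s] is at an end of [c], it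
   belongs to one factor and is independent of the others; if not, it is independent of [c], because
   lengthening [c] would put [linv s] at both ends of a cyclically reduced element. *)
have [o ho] : exists o : option 'I_n, forall l, o <> Some l -> indx s (q l).
  have [|f1] := boolP (first s c).
    rewrite cE => /(first_prodX oq m0)[i /first_mem fi]; exists (Some i) =>
      l il.
    by move: fi; apply/orthoP/oq => e; apply: il; rewrite e.
  have [|f2] := boolP (first s c^-1).
    rewrite cE => /(first_prodXV oq m0)[i /first_mem fi]; exists (Some i) =>
      l il.
    by move: fi; apply/orthoP; rewrite orthoVl; apply: oq => e; apply: il;
      rewrite e.
  case/orP: (longP f1 f2) => [lc|ic].
    have /ccs : first (linv s) (c ^ letter s) by rewrite first_long // eqxx.
    by rewrite -conjVg first_long ?longV // eqxx.
  exists None => l _; move: ic; rewrite cE =>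
    /(indx_prod (ortho_familyX m oq)) /(_ l).
  by have := m0 l; case: (m l) => // k _; rewrite cycred_indx //;
    apply: cycred_factor cc l.
have half i j : i <> j -> indx s (q i) ->
  ortho (q i ^ letter s) (q j ^ letter s).
  move=> ij si; rewrite (_ : q i ^ _ = q i); last first.
    exact/conjg_fixE/commute_sym/indx_commute.
  have osi : ortho (q i) (letter s) by apply/ortho_sym; rewrite ortho_letter.
  by apply: orthoMr; [rewrite orthoVr|apply: orthoMr => //; apply: oq].
move=> i j ij; have [e|/eqP ne] := eqVneq o (Some i).
  apply/ortho_sym/half; first by move=> e'; apply: ij.
  by apply: ho; rewrite e => -[].
by apply: half => //; apply: ho.
Qed.

Lemma ortho_conj n (q : 'I_n -> G) (m : 'I_n -> nat) c g :
  ortho_family q -> (forall i, 0 < m i)%N -> c = \prod_(i < n) q i ^+ m i ->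
  cycred c -> cycred (c ^ g) -> ortho_family (fun i => q i ^ g).
Proof.
have : red (rd g) by apply: red_rd.
rewrite -{2 3}(rdK g); elim: (rd g) q c => [|s u IH] q c.
  move=> _ oq _ _ _ _ i j ij; rewrite eval_nil !conjg1; exact: oq.
move=> /= /andP[ns ru] oq m0 cE cc; rewrite eval_cons => ccg.
have fs : first s (letter s * eval u) by rewrite first_letterM first_eval.
have ccs := cycred_conj_letter cc ccg fs.
have oqs := ortho_conj_letter oq m0 cE cc ccs.
have csE : c ^ letter s = \prod_(i < n) (q i ^ letter s) ^+ m i.
  by rewrite cE conjg_prod; apply: eq_bigr => i _; rewrite conjXg.
move: ccg; rewrite conjgM => ccg i j ij; rewrite !conjgM.
exact: (IH _ _ ru oqs m0 csE ccs ccg).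
Qed.

(** * First letters of primitive factors *)

Lemma firsts_factors n (p : 'I_n -> G) (m : 'I_n -> nat) w :
  w = \prod_(i < n) p i ^+ m i -> (forall i, 0 < m i)%N ->
  (forall g, cycred (w ^ g) -> ortho_family (fun i => p i ^ g)) -> firsts p w.
Proof.
move=> wE m0 op; have [c [u [wc cc lc]]] := cycred_ex w.
set g := eval u in wc.
have cE : c = w ^ g^-1 by rewrite wc conjgK.
have oq : ortho_family (fun i => p i ^ g^-1) by apply: op; rewrite -cE.
have := @first_conj_prodX _ (fun i => p i ^ g^-1) m c u oq m0.
rewrite -/g -wc (_ : (fun i => (p i ^ g^-1) ^ g) = p).
  apply=> //; rewrite cE wE conjg_prod; apply: eq_bigr => i _; exact: conjXg.
by apply: funext => i; rewrite conjgKV.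
Qed.

(** Conjugation by [y] keeps the orthogonality condition, since [a] cyclically reduces [w ^ y]
    exactly when [y * a] cyclically reduces [w]. *)
Lemma firsts_factors_conj n (p : 'I_n -> G) (m : 'I_n -> nat) w y :
  prim_decomp S w p m -> firsts (fun i => p i ^ y) (w ^ y).
Proof.
case=> wE _ m0 op; apply: (@firsts_factors _ _ m) => //.
  by rewrite wE conjg_prod; apply: eq_bigr => i _; rewrite conjXg.
move=> a ca i j ij; apply/orthogonalP.
have conjE x g : x ^ g = g^-1 * x * g by rewrite /conjg mulgA.
rewrite -!conjgM !conjE.
by apply: op => //; apply/XsetP; rewrite conjgM.
Qed.

(** * Existence of the primitive decomposition *)

Lemma radd_last s x : first s x^-1 -> radd (x * letter s) (letter (linv s)).
Proof.
by move=> f; rewrite raddV invgM -!letterV linvK letterV -sub_radd -first_sub.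
Qed.

Lemma meet_coprime x y : coprime ((meet S x y)^-1 * x) ((meet S x y)^-1 * y).
Proof.
have [ex ey eP] := meetP x y; set e := meet S x y in ex ey eP *.
have [rx ry] : radd e (e^-1 * x) /\ radd e (e^-1 * y) by rewrite -!sub_radd.
move=> a /first_sub fx; apply/negP => /first_sub fy.
have ex' := sub_mul2l_radd rx fx; have ey' := sub_mul2l_radd ry fy.
rewrite !mulVKg in ex' ey'; have /sub_len := eP _ ex' ey'.
by have /eqP -> := radd_sub rx fx; rewrite len_letter; glia.
Qed.

(** With [e] the meet of [x] and [y], the factors of [x^-1 * y = (e^-1 * x)^-1 * (e^-1 * y)] are
    orthogonal. So a step towards [y] either removes a last letter of [x] or appends a first letter
    of [e^-1 * y]. *)
Lemma interval_step x y z s : sub x z -> sub y z -> first s (x^-1 * y) ->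
  sub (x * letter s) z.
Proof.
move=> xz yz fs; have [f|nf] := boolP (first s x^-1).
  apply: sub_trans xz; have := radd_last f.
  by rewrite -sub_mulr letterV mulgK.
have [ex ey _] := meetP x y; have := @meet_coprime x y.
set e := meet S x y in ex ey * => cxy.
have rx : radd e (e^-1 * x) by rewrite -sub_radd.
have rz : radd e (e^-1 * z) by rewrite -sub_radd; apply: sub_trans xz.
have sb t : sub e t -> sub t z -> sub (e^-1 * t) (e^-1 * z).
  by move=> et tz; apply/(@sub_mul2l e); rewrite ?mulVKg // -sub_radd.
have [oxy xyz] := coprime_bounded cxy (sb _ ex xz) (sb _ ey yz).
move: fs; have -> : x^-1 * y = (e^-1 * x)^-1 * (e^-1 * y).
  by rewrite invgM invgK -mulgA mulVKg.
rewrite first_mul; last by apply: ortho_radd; rewrite orthoVl.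
case/orP=> [f|/andP[_ /first_sub f]].
  case/negP: nf; rewrite -(mulVKg e x) invgM first_mul ?f //.
  by rewrite -raddV.
have h := sub_mul2l_radd (ortho_radd oxy) f.
by have := sub_mul2l_radd rz (sub_trans h xyz); rewrite mulgA !mulVKg.
Qed.

(** Convexity of the set of elements below [z], obtained by walking a geodesic from [x]; it serves
    to bound the convex closure in [H]. *)
Lemma interval_bounded x y z t : sub x z -> sub y z -> interval S x y t ->
  sub t z.
Proof.
rewrite /interval /mkset -{2}(mulVKg x t).
have : red (rd (x^-1 * t)) by apply: red_rd.
rewrite -{2 3}(rdK (x^-1 * t)); move: (rd _) => u; elim: u x => [|s u IH] x.
  by rewrite eval_nil mulg1.
move=> /= /andP[ns ru]; rewrite eval_cons mulgA => xz yz suy.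
have fs : first s (letter s * eval u) by rewrite first_letterM first_eval.
apply: IH => //; first exact: interval_step xz yz (first_mono suy fs).
by have := sub_letterVM fs suy; rewrite mulKg invgM mulgA.
Qed.

Lemma cycred_len (v : G) n : cycred v -> len (v ^+ n) = (n * len v)%N.
Proof.
move=> cv; elim: n => [|n IH]; first by rewrite len1.
by rewrite expgS; have /eqP -> := cycred_radd n cv; rewrite IH mulSn.
Qed.

Lemma cycred_radd_exp (v : G) m n : cycred v -> radd (v ^+ m) (v ^+ n).
Proof. by move=> cv; rewrite /radd -expgnDr !cycred_len // mulnDl. Qed.

Lemma cycred_sub_exp (v : G) m n : cycred v -> (m <= n)%N ->
  sub (v ^+ m) (v ^+ n).
Proof.
by move=> cv mn; rewrite -(subnKC mn) expgnDr sub_mulr cycred_radd_exp.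
Qed.

(* Since the projections of v^N to a pair of dependent generators are totally
   ordered prefixes, each projection of the meet is that of x or that of y. *)
Lemma meet_commute (v x y : G) n : cycred v -> commute x v -> commute y v ->
  sub x (v ^+ n) -> sub y (v ^+ n) -> commute (meet S x y) v.
Proof.
move=> cv cx cy xn yn; have [ex ey _] := meetP x y; have := @meet_coprime x y.
set e := meet S x y in ex ey * => cxy.
have rn : radd e (e^-1 * v ^+ n) by rewrite -sub_radd; apply: sub_trans xn.
have sb t : sub e t -> sub t (v ^+ n) -> sub (e^-1 * t) (e^-1 * v ^+ n).
  by move=> et tz; apply/(@sub_mul2l e); rewrite ?mulVKg // -sub_radd.
have [/allP oxy _] := coprime_bounded cxy (sb _ ex xn) (sb _ ey yn).
have comm t : sub e t -> commute t v -> sub t (v ^+ n) ->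
    treq ((rd e ++ rd (e^-1 * t)) ++ rd v) (rd v ++ (rd e ++ rd (e^-1 * t))).
  move=> et ct tn; have lt : len t = (len e + len (e^-1 * t))%N.
    by apply/esym; exact: et.
  have rvt : radd v t by apply: radd_sub tn; apply: cycred_radd.
  apply: red_treq; rewrite ?redE !eval_cat !rdK !mulVKg ?ct // !size_cat
    !size_rd.
    by move/eqP: rvt => ->; rewrite lt addnC.
  by move/eqP: rvt => ->; rewrite lt.
suff h : treq (rd e ++ rd v) (rd v ++ rd e).
  by have := treq_eval h; rewrite !eval_cat !rdK.
have hx := comm x ex cx xn; have hy := comm y ey cy yn => a b ab.
move: (hx _ _ ab) (hy _ _ ab).
rewrite !pairproj_cat; case Ex: (pairproj a b (rd (e^-1 * x))) => [|c u].
  by rewrite !cats0.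
case Ey: (pairproj a b (rd (e^-1 * y))) => [|d w]; first by rewrite !cats0.
(* If both remainders had a nonempty projection, a letter of each would make up the dependent pair
   [a], [b], although the remainders are orthogonal. *)
have := mem_head c u; rewrite -Ex mem_filter => /andP[hc /oxy /allP icd].
have := mem_head d w; rewrite -Ey mem_filter => /andP[hd /icd {}icd].
case/negP: ab; move: icd hc hd; rewrite /ind => /andP[n' /eqP e'].
move=> /orP[]/eqP hc /orP[]/eqP hd.
- by rewrite hc hd eqxx in n'.
- by rewrite -hc -hd n' e' eqxx.
- by rewrite -hc -hd eq_sym n' e' eqxx.
- by rewrite hc hd eqxx in n'.
Qed.

Lemma commute_sub x y : radd x y -> commute y (x * y) -> sub y (x * y).
Proof.
move=> /eqP r cy; rewrite /Defs.sub r.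
have -> : y^-1 * (x * y) = x by apply: (mulgI y); rewrite mulVKg;
  apply: (mulIg y); rewrite -cy mulgA.
exact: addnC.
Qed.

Lemma conjgVE x g : g^-1 * x * g = x ^ g.
Proof. by rewrite /conjg mulgA. Qed.

Lemma H_bounded (v u : G) : cycred v -> H S v u ->
  commute u v /\ exists n, sub (v ^+ n * u) (v ^+ (n + n)).
Proof.
move=> cv [cu Xu]; split=> //.
(* The union of the intervals from [v ^- n] to [v ^+ n]. They increase with [n], so two points lie
   in a common one. *)
pose C : set G := [set z | exists n, sub (v ^+ n * z) (v ^+ (n + n))].
suff : C u by [].
apply: Xu; split=> [x y [m xm] [n yn] z xyz|z [n [->|->]]].
- have shift t k l : sub (v ^+ k * t) (v ^+ (k + k)) ->
      sub (v ^+ (l + k) * t) (v ^+ (l + k + (l + k))).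
    move=> h; rewrite expgnDr -mulgA.
    apply: (@sub_trans (v ^+ (l + (k + k)))); last first.
      by apply: cycred_sub_exp => //; lia.
    by rewrite [v ^+ (l + _)]expgnDr; apply: sub_mul2l_radd => //;
      apply: cycred_radd_exp.
  exists (m + n)%N; have := shift y n m yn.
  have := shift x m n xm; rewrite [(n + m)%N]addnC => hx hy.
  apply: (interval_bounded hx hy).
  by rewrite /interval /mkset !invgM -!mulgA !mulKg.
- by exists n; rewrite -expgnDr; apply: subxx.
- by exists n; rewrite mulgV; apply: sub1x.
Qed.

Lemma zpowers_H (v : G) : zpowers v `<=` H S v.
Proof.
move=> z zv; split=> [|A [_]]; last by apply.
case: zv => n [->|->]; apply/commute_sym; last apply: commuteV.
  exact/commuteX/commute_refl.
exact/commuteX/commute_refl.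
Qed.

(** The meet of [v] and [x] commutes with [v], so it is 1 or [v]. In the first case [x = 1], since
    all first letters of [x] are first letters of [v]; in the second, divide by [v]. *)
Lemma atom_powers (v x : G) n : cycred v ->
  (forall q, q <> 1 -> sub q v -> commute q v -> q = v) ->
  commute x v -> sub x (v ^+ n) -> exists k, x = v ^+ k.
Proof.
move=> cv atom; elim: n x => [|n IH] x cx xn.
  by exists 0%N; rewrite (subx1 xn).
have vn : sub v (v ^+ n.+1) by rewrite -{1}[v]expg1; apply: cycred_sub_exp.
have cm := meet_commute cv (commute_refl v) cx vn xn.
have [mv mx _] := meetP v x; have [m1|/eqP m1] := eqVneq (meet S v x) 1.
  exists 0%N; have [//|/eqP /first_ex [a fa]] := eqVneq x 1.
  have := meetP v x; rewrite m1 => /glb_coprime /(_ a) cvx.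
  have := first_mono xn fa; rewrite cycred_first // => /cvx.
  by rewrite fa.
rewrite (atom _ m1 mv cm) in mx.
have [||k xk] := IH (v^-1 * x).
- apply/commute_sym/commuteM/commute_sym => //; exact/commuteV/commute_refl.
- apply/(@sub_mul2l v); rewrite -?sub_radd ?mulVKg -?expgS //.
  exact: cycred_radd.
by exists k.+1; rewrite expgS -xk mulVKg.
Qed.

Lemma atom_H (v : G) : cycred v ->
  (forall q, q <> 1 -> sub q v -> commute q v -> q = v) -> H S v = zpowers v.
Proof.
move=> cv atom; apply/seteqP; split; last exact: zpowers_H.
move=> u /(H_bounded cv)[cu [n un]].
have [|k uk] := @atom_powers v _ _ cv atom _ un.
  apply/commute_sym/commuteM/commute_sym => //; exact/commuteX/commute_refl.
have {uk} -> : u = v ^- n * v ^+ k by rewrite -uk mulKg.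
have [kn|/ltnW nk] := leqP k n.
  exists (n - k)%N; right; by rewrite -{1}(subnKC kn) expgnDr invgM mulgVK.
by exists (k - n)%N; left; rewrite -{1}(subnKC nk) expgnDr mulKg.
Qed.

Lemma min_len (P : G -> Prop) : (exists x, P x) ->
  exists2 x, P x & forall y, P y -> (len x <= len y)%N.
Proof.
case=> x; have [n] := ubnP (len x); elim: n x => // n IH x xn Px.
have [[y [Py yx]]|h] := pselect (exists y, P y /\ (len y < len x)%N).
  by apply: (IH y) => //; lia.
exists x => // y Py; rewrite leqNgt; apply/negP => yx; apply: h; by exists y.
Qed.

(** Commuting with [c] makes the prefix [y] a suffix of [c] as well, so an obstruction in [y] is one
    in [c]. *)
Lemma cycred_sub (c y : G) : cycred c -> commute y c -> sub y c -> cycred y.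
Proof.
move=> cc cy yc a fa; apply/negP => fVa.
have /cc/negP := first_mono yc fa; apply; apply: first_mono fVa.
have e : c = y^-1 * c * y by rewrite -mulgA -cy mulKg.
rewrite [in c^-1]e invgM sub_mulr -raddV /radd -e; apply/eqP.
by rewrite -yc addnC.
Qed.

(* [p ^+ k] is the largest power of p below y. *)
Lemma split_power (c p y : G) : cycred c -> p <> 1 -> sub p c -> commute p c ->
  (forall q, q <> 1 -> sub q c -> commute q c -> (len p <= len q)%N) ->
  sub y c -> commute y c ->
  exists k z, [/\ y = p ^+ k * z, commute z c, sub z c & coprime p z].
Proof.
move=> cc p1 pc cp pmin; have [n] := ubnP (len y); elim: n y =>
  // n IH y yn yc cy.
have cm := @meet_commute c p y 1 cc cp cy pc yc.
have [mp my _] := meetP p y; have [m1|/eqP m1] := eqVneq (meet S p y) 1.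
  exists 0%N, y; rewrite mul1g; split=> //.
  by have := meetP p y; rewrite m1; apply: glb_coprime.
have mE : meet S p y = p.
  by apply: sub_len_eq => //; apply: pmin => //; apply: sub_trans pc.
rewrite mE in my; set z := p^-1 * y.
have cz : commute z c.
  apply/commute_sym/commuteM/commute_sym => //; exact/commuteV/commute_sym.
have yE : y = p * z by rewrite mulVKg.
have rp : radd p z by rewrite -sub_radd.
(* [z] is a suffix of [c = (y^-1 * c * p) * z], and since it commutes with [c] it is also a
   prefix. *)
have zc : sub z c.
  have e : c = (y^-1 * c * p) * z.
    by rewrite -[RHS]mulgA -yE -mulgA -cy mulKg.
  have ce : commute z ((y^-1 * c * p) * z) by rewrite -e.
  rewrite [c]e; apply: commute_sub => //.
  have ry : len c = (len y + len (y^-1 * c))%N by apply/esym; exact: yc.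
  move/eqP: rp; rewrite -yE => ly.
  have := lenM (y^-1 * c) p; have := lenM (y^-1 * c * p) z.
  by rewrite /radd -e => h1 h2; apply/eqP; glia.
have [|k [t [zE ct tc pt]]] := IH z _ zc cz.
  move/eqP: rp; rewrite -yE; have : len p != 0%N by rewrite len_eq0; apply/eqP.
  by move: yn; glia.
by exists k.+1, t; split=> //; rewrite expgS -mulgA -zE.
Qed.

Lemma indx_factor n (q : 'I_n -> G) (m : 'I_n -> nat) c a :
  ortho_family q -> (forall i, 0 < m i)%N -> (forall i, cycred (q i)) ->
  c = \prod_(i < n) q i ^+ m i -> indx a c -> forall i, indx a (q i).
Proof.
move=> oq m0 cq -> /(indx_prod (ortho_familyX m oq)) h i; move: (h i) (m0 i).
by case: (m i) => // k; rewrite cycred_indx.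
Qed.

Lemma cycred_decomp c : cycred c ->
  exists n (q : 'I_n -> G) (m : 'I_n -> nat),
    [/\ c = \prod_(i < n) q i ^+ m i, forall i, (0 < m i)%N, ortho_family q &
        forall i, [/\ q i <> 1, cycred (q i) & H S (q i) = zpowers (q i)]].
Proof.
have [k] := ubnP (len c); elim: k c => // k IH c ck cc.
have [c1|/eqP c1] := eqVneq c 1.
  exists 0%N, (fun=> 1), (fun=> 0%N); split; first by rewrite big_ord0.
  - by case.
  - by move=> [].
  - by case.
have [|p [p1 pc cp] pmin] := @min_len (fun p =>
  [/\ p <> 1, sub p c & commute p c]).
  by exists c; split=> //; apply: subxx.
have pmin' q : q <> 1 -> sub q c -> commute q c -> (len p <= len q)%N.
  by move=> *; apply: pmin.
have ccp := cycred_sub cc cp pc.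
have [j [z [cE cz zc cpz]]] := split_power cc p1 pc cp pmin' (subxx c)
  (commute_refl c).
have [opz _] := coprime_bounded cpz pc zc.
(* This excludes [z = c], so that the induction descends, and also [j = 0]. *)
have Ncpc : ~ coprime p c.
  have [a fa] := first_ex p1 => /(_ a fa) /negP; apply; exact: first_mono fa.
have zlt : (len z < len c)%N.
  rewrite ltnNge; apply/negP => /(sub_len_eq zc) zE; apply: Ncpc.
  by rewrite -zE.
have j0 : (0 < j)%N.
  by case: j cE => // cE; case: Ncpc; rewrite cE mul1g.
have ccz := cycred_sub cc cz zc.
have [|n [q [m [zE m0 oq qP]]]] := IH z _ ccz; first by lia.
have opq i : ortho p (q i).
  apply/orthoP => a ap; apply: (indx_factor oq m0 _ zE) => [l|].
    by have [] := qP l.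
  by move/orthoP: opz; apply.
pose q' (i : 'I_n.+1) := if unlift ord0 i is Some l then q l else p.
pose m' (i : 'I_n.+1) := if unlift ord0 i is Some l then m l else j.
exists n.+1, q', m'; split.
- rewrite big_ord_recl /q' /m' unlift_none {1}cE zE; congr (_ * _).
  by apply: eq_bigr => i _; rewrite liftK.
- by move=> i; rewrite /m'; case: unlift.
- move=> i l il; rewrite /q'; case: unliftP => [i'|] iE; case: unliftP =>
  [l'|] lE.
  + by apply: oq => e; apply: il; rewrite iE lE e.
  + exact/ortho_sym.
  + exact: opq.
  + by case: il; rewrite iE lE.
- move=> i; rewrite /q'; case: unlift => [i'|]; first exact: qP.
  (* A prefix of [p] is orthogonal to [z], so if it commutes with [p] it commutes with [c], and
     minimality applies. *)
  split=> //; apply: atom_H => // s s1 sp cs.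
  apply: sub_len_eq => //; apply: pmin'; first by [].
    exact: sub_trans pc.
  rewrite cE; apply: commuteM; first exact: commuteX.
  exact/ortho_commute/(ortho_mono sp).
Qed.

Lemma prim_decomp_ex w :
  exists n (p : 'I_n -> G) (m : 'I_n -> nat), prim_decomp S w p m.
Proof.
have [c [u [wc cc _]]] := cycred_ex w; set g := eval u in wc.
have [n [q [m [cE m0 oq qP]]]] := cycred_decomp cc.
exists n, (fun i => q i ^ g), m; split=> //.
- by rewrite wc cE conjg_prod; apply: eq_bigr => i _; rewrite conjXg.
- move=> i; have [q1 cq Hq] := qP i; split.
    by move/eqP; rewrite conjg_eq1 => /eqP.
  exists g^-1; rewrite conjgVE conjgK; split=> //.
  by apply/XsetP; rewrite conjgK.
- move=> i j ij x /XsetP; rewrite wc -conjgM => cx.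
  rewrite !conjgVE -!conjgM; apply/orthogonalP.
  exact: (ortho_conj oq m0 cE cc cx).
Qed.

Lemma prec_radd w x y : prec S w x y <-> radd (x^-1 * y) (w ^ y).
Proof.
by rewrite -sub_mulr /prec /interval /mkset /conjg -!mulgA mulVKg.
Qed.

End Group.

Theorem corollary8p15 (G : groupType) (S : set G) (GS : is_raag S) (w : G) :
  forall x y : G,
    prec S w x y <-> (forall p : G, Prim S w p -> prec S p x y).
Proof.
move=> x y; rewrite prec_radd //; split=> [/raddP h p|h].
  case=> n [q [m [wd [i ->]]]]; apply/prec_radd => //; apply/(raddP GS) => a f.
  apply/negP => fq; case/negP: (h GS a f).
  by apply/(firsts_factors_conj GS y wd); exists i.
have [n [q [m wd]]] := prim_decomp_ex GS w.
apply/(raddP GS) => a f; apply/negP => /(firsts_factors_conj GS y wd)[i].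
apply/negP; move: f; apply/raddP => //; apply/prec_radd => //; apply: h.
by exists n, q, m; split=> //; exists i.
Qed.
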